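(* Let $L\subseteq\Sigma^*$ be a language over a finite alphabet $\Sigma$, and let $X_L=\overline{\operatorname{span}}\{\mathbf 1_{w^{-1}L}:w\in\Sigma^*\}\subset\ell_\infty(\Sigma^* )$. Then the following assertions are equivalent: 1. $L$ is regular; 2. $X_L$ is finite-dimensional; 3. $X_L$ is superreflexive; 4. $X_L$ admits an equivalent uniformly convex norm.
   Context: All Banach spaces are real. $\Sigma$ is a finite nonempty alphabet, $\Sigma^*$ is the free monoid of finite words over $\Sigma$ under concatenation, and a language is a subset $L\subseteq\Sigma^*$. For $w\in\Sigma^*$, the left derivative is $w^{-1}L=\{v\in\Sigma^*:wv\in L\}$, and $\mathbf 1_B$ denotes the characteristic function of a set $B$. $\ell_\infty(\Sigma^* )$ is the space of bounded real functions on $\Sigma^*$ with the supremum norm; the closure is in this norm. A Banach space $Y$ is finitely representable in $X$ if for every finite-dimensional subspace $E\subseteq Y$ and every $\varepsilon>0$ there exist a finite-dimensional subspace $G\subseteq X$ and an isomorphism $T:E\to G$ with $\|T\|\,\|T^{-1}\|<1+\varepsilon$. $X$ is superreflexive if every Banach space finitely representable in $X$ is reflexive. A language is regular if it is recognized by a finite deterministic automaton. *)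

(* Defs.v *)
From HB Require Import structures.
From mathcomp Require Import all_boot all_order all_algebra.
From mathcomp Require Import all_classical all_reals all_analysis.
Set Implicit Arguments.
Unset Strict Implicit.
Unset Printing Implicit Defensive.
Import Order.TTheory GRing.Theory Num.Theory.
Import numFieldNormedType.Exports.
Local Open Scope classical_set_scope.
Local Open Scope ring_scope.

Section Languages.
Variable Sigma : finType.
Implicit Types (L : set (seq Sigma)) (w : seq Sigma).

Definition lderiv w L : set (seq Sigma) := [set v | L (w ++ v)].

Definition regular L : Prop :=
  exists (Q : finType) (q0 : Q) (delta : Q -> Sigma -> Q) (final : {set Q}),
    L = [set w | foldl delta q0 w \in final].

End Languages.

Section OperatorNorm.
Context {R : realType} {V W : normedModType R}.
Implicit Types (E : set V) (f : V -> W).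

(* The norm of the restriction of [f] to [E]; it is [+oo] exactly when that
   restriction is unbounded on the unit ball of [E]. *)
Definition opnorm E f : \bar R :=
  ereal_sup [set `|f x|%:E | x in [set x | E x /\ `|x| <= 1]].

Lemma opnorm_ub E f x : E x -> `|x| <= 1 -> (`|f x|%:E <= opnorm E f)%E.
Proof. by move=> Ex x1; apply: ereal_sup_ubound; exists x. Qed.

Lemma opnorm_le E f (M : R) :
  (forall x, E x -> `|x| <= 1 -> `|f x| <= M) -> (opnorm E f <= M%:E)%E.
Proof.
by move=> fM; apply: ge_ereal_sup => _ [x [Ex x1] <-]; rewrite lee_fin fM.
Qed.

End OperatorNorm.

Section Span.
Context {R : realType} {V : normedModType R}.
Implicit Types (S E : set V).

Definition lspan S : set V := [set x | exists n (a : 'I_n -> R) (v : 'I_n -> V),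
  (forall i, S (v i)) /\ x = \sum_(i < n) a i *: v i].

Definition findim_subspace E : Prop := exists s : seq V, E = lspan [set` s].

Lemma lspan_submod S : lspan S 0 /\
  forall a x y, lspan S x -> lspan S y -> lspan S (a *: x + y).
Proof.
split; first by exists 0%N, (fun=> 0), (fun=> 0); split=> [[]//|]; rewrite big_ord0.
move=> c _ _ [n [a [v [Sv ->]]]] [m [b [u [Su ->]]]].
exists (n + m)%N, (fun i : 'I_(n + m) => match fintype.split i with inl j => c * a j | inr j => b j end),
  (fun i : 'I_(n + m) => match fintype.split i with inl j => v j | inr j => u j end); split.
  by move=> i; case: fintype.split.
rewrite big_split_ord /= scaler_sumr; congr (_ + _); apply: eq_bigr => i _.
  by rewrite -[lshift m i]/(unsplit (inl i)) unsplitK scalerA.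
by rewrite -[rshift n i]/(unsplit (inr i)) unsplitK.
Qed.

End Span.

Definition finite_dimensional {R : realType} (V : normedModType R) : Prop :=
  findim_subspace [set: V].

Section ClosedSpan.
Context {R : realType} {V : normedModType R}.
Variable S : set V.

Definition clspan_pred : {pred V} := fun x => `[< closure (lspan S) x >].

Lemma clspan_submod : submod_closed clspan_pred.
Proof.
have [S0 SD] := lspan_submod S.
split=> [|a x y /asboolP Sx /asboolP Sy]; apply/asboolP.
  exact: subset_closure.
move=> B Bxy.
have : (fun z : V * V => a *: z.1 + z.2) @ (x, y) --> a *: x + y.
  apply: cvgD; last exact: cvg_snd.
  by apply: cvgZ; [exact: cvg_cst|exact: cvg_fst].
move=> /(_ B Bxy) [[P Q] /= [Px Qy] PQB].
have [x' [Sx' Px']] := Sx _ Px; have [y' [Sy' Qy']] := Sy _ Qy.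
exists (a *: x' + y'); split; first exact: SD.
exact: (PQB (x', y')).
Qed.

HB.instance Definition _ :=
  GRing.isSubmodClosed.Build R V clspan_pred clspan_submod.

Record clspan : Type :=
  Clspan { clspan_val :> V; clspan_valP : clspan_val \in clspan_pred }.

HB.instance Definition _ := [isSub for clspan_val].
HB.instance Definition _ := [Choice of clspan by <:].
HB.instance Definition _ := [SubChoice_isSubLmodule of clspan by <:].

Let nrm (x : clspan) : R := `|val x|.
Let nrmD x y : nrm (x + y) <= nrm x + nrm y.
Proof. by rewrite /nrm raddfD ler_normD. Qed.
Let nrmZ (a : R) x : nrm (a *: x) = `|a| * nrm x.
Proof. by rewrite /nrm linearZ normrZ. Qed.
Let nrm0 x : nrm x = 0 -> x = 0.
Proof. by move=> /normr0_eq0 x0; apply: val_inj; rewrite x0 raddf0. Qed.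

HB.instance Definition _ := Lmodule_isNormed.Build R clspan nrmD nrmZ nrm0.

Lemma clspan_normE (x : clspan) : `|x| = `|clspan_val x|.
Proof. by []. Qed.

End ClosedSpan.
Arguments clspan_val {R V S}.
Arguments clspan_valP {R V S}.

Section ClosedSpanComplete.
Context {R : realType} {V : completeNormedModType R}.
Variable S : set V.

Lemma clspan_complete (F : set_system (clspan S)) :
  ProperFilter F -> cauchy F -> cvg F.
Proof.
move=> FF /cauchy_ballP cF.
have cvF : cvg (clspan_val x @[x --> F]).
  apply: cauchy_cvg; apply/cauchy_ballP => e e0.
  have [[P Q] /= [FP FQ] PQ] := cF e e0.
  exists (clspan_val @` P, clspan_val @` Q) => /=.
    by split; [apply: filterS FP|apply: filterS FQ] => x Px; exists x.
  move=> [_ _] [/= [x Px <-] [y Qy <-]].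
  have := PQ (x, y) (conj Px Qy).
  by rewrite /= -!ball_normE /ball_ /= clspan_normE.
set l := lim _ in cvF.
have Sl : l \in clspan_pred S.
  apply/asboolP; apply: (@closed_cvg _ _ F FF clspan_val) cvF => //.
    exact: closed_closure.
  by apply: nearW => x; apply/asboolP; exact: clspan_valP.
apply/cvg_ex; exists (Clspan Sl).
apply/cvgrPdist_lt => e e0; near=> x; rewrite clspan_normE /=.
by near: x; move/cvgrPdist_lt : cvF; apply.
Unshelve. all: by end_near. Qed.

HB.instance Definition _ := Uniform_isComplete.Build (clspan S) clspan_complete.

End ClosedSpanComplete.

Section Linfty.
Context {R : realType} {T : Type}.

Definition linfty_pred : {pred (T -> R^o)} :=
  fun f => `[< exists M : R, forall t, `|f t| <= M >].

Lemma linfty_submod : submod_closed linfty_pred.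
Proof.
split=> [|a f g /asboolP[M fM] /asboolP[N gN]]; apply/asboolP.
  by exists 0 => t; rewrite normr0.
exists (`|a| * M + N) => t; rewrite (le_trans (ler_normD _ _))// lerD//.
by rewrite normrM ler_wpM2l.
Qed.

HB.instance Definition _ :=
  GRing.isSubmodClosed.Build R (T -> R^o) linfty_pred linfty_submod.

End Linfty.
Arguments linfty_pred : clear implicits.

Record linfty (R : realType) (T : Type) : Type := Linfty {
  linfty_fun :> T -> R^o; linfty_funP : linfty_fun \in linfty_pred R T }.

Section LinftyNorm.
Variables (R : realType) (T : Type).
Local Notation linfty := (linfty R T).
Implicit Types f g : linfty.

HB.instance Definition _ := [isSub of linfty for @linfty_fun R T].
HB.instance Definition _ := [Choice of linfty by <:].
HB.instance Definition _ := [SubChoice_isSubLmodule of linfty by <:].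

(* For empty [T] this is [sup set0 = 0]. *)
Definition sup_norm (f : linfty) : R := sup (range (fun t => `|f t|)).

Lemma sup_norm_ub f t : `|f t| <= sup_norm f.
Proof.
apply: ub_le_sup; last by exists t.
by have /asboolP[M fM] := linfty_funP f; exists M => _ [s _ <-].
Qed.

Lemma sup_norm_le f (M : R) : 0 <= M -> (forall t, `|f t| <= M) -> sup_norm f <= M.
Proof.
move=> M0 fM; have [r0|/set0P r0] := eqVneq (range (fun t => `|f t|)) set0.
  by rewrite /sup_norm r0 sup0.
by apply: ge_sup => // _ [t _ <-].
Qed.

Lemma sup_norm_ge0 f : 0 <= sup_norm f.
Proof.
have [r0|/set0P[_ [t _ _]]] := eqVneq (range (fun t => `|f t|)) set0.
  by rewrite /sup_norm r0 sup0.
exact: le_trans (normr_ge0 _) (sup_norm_ub f t).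
Qed.

Lemma sup_normD f g : sup_norm (f + g) <= sup_norm f + sup_norm g.
Proof.
apply: sup_norm_le => [|t]; first by rewrite addr_ge0 ?sup_norm_ge0.
by rewrite (le_trans (ler_normD _ _))// lerD// sup_norm_ub.
Qed.

Lemma sup_normZ (a : R) f : sup_norm (a *: f) = `|a| * sup_norm f.
Proof.
have le b g : sup_norm (b *: g) <= `|b| * sup_norm g.
  apply: sup_norm_le => [|t]; first by rewrite mulr_ge0 ?sup_norm_ge0.
  by rewrite normrM ler_wpM2l// sup_norm_ub.
apply/eqP; rewrite eq_le le /=; have [->|a0] := eqVneq a 0.
  by rewrite normr0 mul0r sup_norm_ge0.
rewrite -ler_pdivlMl ?normr_gt0// -normfV.
by have := le a^-1 (a *: f); rewrite scalerA mulVf// scale1r.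
Qed.

Lemma sup_norm_eq0 f : sup_norm f = 0 -> f = 0.
Proof.
move=> f0; apply: val_inj; apply/funext => t; apply/normr0_eq0/eqP.
by rewrite eq_le normr_ge0 andbT -f0 sup_norm_ub.
Qed.

HB.instance Definition _ :=
  Lmodule_isNormed.Build R linfty sup_normD sup_normZ sup_norm_eq0.

Lemma linfty_normE (f : linfty) : `|f| = sup_norm f.
Proof. by []. Qed.

Lemma linfty_complete (F : set_system linfty) : ProperFilter F -> cauchy F -> cvg F.
Proof.
move=> FF /cauchyP cF.
have cF' e : 0 < e -> exists f : linfty, F [set g : linfty | `|f - g| < e].
  by move=> e0; have [f Ff] := cF e e0; exists f; move: Ff; rewrite -ball_normE.
have lip (f g : linfty) t : `|f t - g t| <= `|f - g|.
  exact: sup_norm_ub (f - g) t.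
have cvt t : cvg (g t @[g --> F]).
  apply: cauchy_cvg; apply: cauchy_exP => e e0.
  have [f Ff] := cF' e e0; exists (f t).
  suff : F [set g : linfty | ball (f t : R^o) e (g t : R^o)] by [].
  apply: filterS Ff => g /= fg; rewrite -ball_normE /ball_ /=.
  exact: le_lt_trans (lip f g t) fg.
pose l t : R^o := lim (g t @[g --> F]).
have fl (e : R) (f : linfty) : F [set g : linfty | `|f - g| < e] ->
    forall t, `|f t - l t| <= e.
  move=> Ff t.
  have cvd : `|f t - g t| @[g --> F] --> `|f t - l t|.
    by apply: cvg_norm; apply: cvgB; [exact: cvg_cst|exact: cvt].
  apply: (closed_cvg (fun x : R => x <= e)) cvd; first exact: closed_le.
  suff : F [set g : linfty | `|f t - g t| <= e] by [].
  by apply: filterS Ff => g /= /ltW; apply: le_trans; exact: lip.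
have lP : l \in linfty_pred R T.
  have [f Ff] := cF' 1 ltr01; apply/asboolP; exists (`|f| + 1) => t.
  rewrite -[l t](subKr (f t)) (le_trans (ler_normB _ _))// lerD//.
    exact: sup_norm_ub.
  exact: fl.
apply/cvg_ex; exists (Linfty lP); apply/cvgrPdist_le => e e0.
have [f Ff] := cF' (e / 2) (divr_gt0 e0 (ltr0n _ 2)).
apply: filterS (Ff) => g /= fg; rewrite -[_ - g](subrKA f) [e]splitr.
rewrite (le_trans (ler_normD _ _))// lerD//; last exact: ltW.
rewrite distrC; apply: sup_norm_le => [|t]; first by rewrite divr_ge0 ?ltW.
exact: fl.
Qed.

HB.instance Definition _ := Uniform_isComplete.Build linfty linfty_complete.

Lemma linfty_indic_subproof (A : set T) : (\1_A : T -> R^o) \in linfty_pred R T.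
Proof.
by apply/asboolP; exists 1 => t; rewrite indicE ger0_norm ?ler0n// lern1 leq_b1.
Qed.

Definition linfty_indic (A : set T) : linfty := Linfty (linfty_indic_subproof A).


End LinftyNorm.

Section Dual.
Context {R : realType} {V : normedModType R}.

Definition dual_pred : {pred (V -> R^o)} :=
  fun f => `[< linear f /\ continuous f >].

Lemma dual_submod : submod_closed dual_pred.
Proof.
split=> [|a f g /asboolP[fl fc] /asboolP[gl gc]]; apply/asboolP.
  split=> [b x y|x]; last exact: cvg_cst.
  by rewrite /= scaler0 addr0.
split=> [b x y|x].
  by rewrite /= !fctE fl gl !scalerDr !scalerA [a * b]mulrC addrACA.
by apply: cvgD; [apply: cvgZ; [exact: cvg_cst|exact: fc]|exact: gc].
Qed.

HB.instance Definition _ :=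
  GRing.isSubmodClosed.Build R (V -> R^o) dual_pred dual_submod.

End Dual.
Arguments dual_pred {R} V.

Record dual (R : realType) (V : normedModType R) : Type := Dual {
  dual_fun :> V -> R^o; dual_funP : dual_fun \in dual_pred V }.

Section DualNorm.
Variables (R : realType) (V : normedModType R).
Local Notation dual := (dual V).
Implicit Types f g : dual.

HB.instance Definition _ := [isSub of dual for @dual_fun R V].
HB.instance Definition _ := [Choice of dual by <:].
HB.instance Definition _ := [SubChoice_isSubLmodule of dual by <:].

Lemma dual_linear f : linear f.
Proof. by have /asboolP[] := dual_funP f. Qed.

Lemma dual_continuous f : continuous f.
Proof. by have /asboolP[] := dual_funP f. Qed.

Lemma dual_scale f (a : R) x : f (a *: x) = a * f x.
Proof.
have f0 : f 0 = 0.
  by have := dual_linear f (-1) 0 0; rewrite scaler0 addr0 scaleN1r addNr.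
by have := dual_linear f a x 0; rewrite f0 !addr0.
Qed.

Lemma dual_opnorm_fin f : opnorm [set: V] f \is a fin_num.
Proof.
pose g : {linear V -> R^o} :=
  HB.pack (dual_fun f) (GRing.isLinear.Build _ _ _ _ _ (dual_linear f)).
have /linear_boundedP : bounded_near g (nbhs (0 : V)).
  by apply/linear_bounded_continuous; exact: dual_continuous.
move=> /pinfty_ex_gt0[M M0 fM].
rewrite fin_numElt; apply/andP; split.
  apply: lt_le_trans (opnorm_ub f (x := 0) I _); first exact: ltNyr.
  by rewrite normr0.
apply: le_lt_trans (opnorm_le (M := M) _) (ltry _) => x _ x1.
by rewrite (le_trans (fM x))// ler_piMr// ltW.
Qed.

Definition dual_norm f : R := fine (opnorm [set: V] f).

Lemma dual_normE f : (dual_norm f)%:E = opnorm [set: V] f.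
Proof. by rewrite fineK// dual_opnorm_fin. Qed.

Lemma dual_norm_ub1 f x : `|x| <= 1 -> `|f x| <= dual_norm f.
Proof. by move=> x1; rewrite -lee_fin dual_normE; exact: opnorm_ub. Qed.

Lemma dual_norm_le f (M : R) :
  (forall x, `|x| <= 1 -> `|f x| <= M) -> dual_norm f <= M.
Proof.
by move=> fM; rewrite -lee_fin dual_normE; apply: opnorm_le => x _; exact: fM.
Qed.

Lemma dual_norm_ge0 f : 0 <= dual_norm f.
Proof. by apply: le_trans (dual_norm_ub1 f (x := 0) _); rewrite ?normr0. Qed.

Lemma dual_normD f g : dual_norm (f + g) <= dual_norm f + dual_norm g.
Proof.
apply: dual_norm_le => x x1.
by rewrite (le_trans (ler_normD _ _))// lerD// dual_norm_ub1.
Qed.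

Lemma dual_normZ (a : R) f : dual_norm (a *: f) = `|a| * dual_norm f.
Proof.
have le b g : dual_norm (b *: g) <= `|b| * dual_norm g.
  by apply: dual_norm_le => x x1; rewrite normrM ler_wpM2l// dual_norm_ub1.
apply/eqP; rewrite eq_le le /=; have [->|a0] := eqVneq a 0.
  by rewrite normr0 mul0r dual_norm_ge0.
rewrite -ler_pdivlMl ?normr_gt0// -normfV.
by have := le a^-1 (a *: f); rewrite scalerA mulVf// scale1r.
Qed.

Lemma dual_norm_eq0 f : dual_norm f = 0 -> f = 0.
Proof.
move=> f0; apply: val_inj; apply/funext => x; apply/normr0_eq0/eqP.
rewrite -[\val f x]/(dual_fun f x).
have [->|x0] := eqVneq x 0.
  have fz : f 0 = 0 by have := dual_scale f 0 0; rewrite scale0r mul0r.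
  by rewrite fz normr0.
have nx : 0 < `|x| by rewrite normr_gt0.
have : `|f (`|x|^-1 *: x)| <= dual_norm f.
  by apply: dual_norm_ub1; rewrite normrZ normfV normr_id mulVf// gt_eqF.
rewrite f0 dual_scale normrM pmulr_rle0; last by rewrite normr_gt0 invr_neq0 ?gt_eqF.
by move=> fx; rewrite eq_le fx normr_ge0.
Qed.

HB.instance Definition _ :=
  Lmodule_isNormed.Build R dual dual_normD dual_normZ dual_norm_eq0.

End DualNorm.

Section BanachProperties.
Context {R : realType}.

(* Surjectivity of the canonical map of [X] into its bidual. *)
Definition reflexive_space (X : normedModType R) : Prop :=
  forall phi : dual (dual X), exists x : X, forall f : dual X, phi f = f x.

Definition linear_on (V W : normedModType R) (E : set V) (f : V -> W) : Prop :=
  forall (a : R) x y, E x -> E y -> f (a *: x + y) = a *: f x + f y.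

(* [T] and [U] are mutually inverse linear bijections between [E] and [G];
   their values outside these subspaces are irrelevant. *)
Definition isomorphism_between (Y X : normedModType R) (E : set Y) (G : set X)
    (T : Y -> X) (U : X -> Y) : Prop :=
  [/\ linear_on E T, set_fun E G T, set_fun G E U,
      {in E, cancel T U} & {in G, cancel U T}].

Definition finitely_representable (Y X : normedModType R) : Prop :=
  forall E : set Y, findim_subspace E -> forall e : R, 0 < e ->
  exists (G : set X) (T : Y -> X) (U : X -> Y),
    [/\ findim_subspace G, isomorphism_between E G T U &
        (opnorm E T * opnorm G U < (1 + e)%:E)%E].

Definition superreflexive (X : normedModType R) : Prop :=
  forall Y : completeNormedModType R,
    finitely_representable Y X -> reflexive_space Y.

Definition is_norm (X : lmodType R) (N : X -> R) : Prop :=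
  [/\ forall x y, N (x + y) <= N x + N y,
      forall (a : R) x, N (a *: x) = `|a| * N x &
      forall x, N x = 0 -> x = 0].

Definition equivalent_norm (X : normedModType R) (N : X -> R) : Prop :=
  is_norm N /\ exists c C : R,
    [/\ 0 < c, 0 < C & forall x, c * `|x| <= N x <= C * `|x|].

Definition uniformly_convex (X : lmodType R) (N : X -> R) : Prop :=
  forall e : R, 0 < e -> exists2 d : R, 0 < d &
    forall x y, N x = 1 -> N y = 1 -> e <= N (x - y) ->
      N (2^-1 *: (x + y)) <= 1 - d.

End BanachProperties.

Definition XL (R : realType) (Sigma : finType) (L : set (seq Sigma)) :
    completeNormedModType R :=
  clspan [set linfty_indic R (lderiv w L) | w in [set: seq Sigma]].

(* Main.v *)
Require Import Defs.
From HB Require Import structures.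
From mathcomp Require Import all_boot all_order all_algebra.
From mathcomp Require Import all_classical all_reals all_analysis.
From mathcomp Require Import ring lra zify.

Set Implicit Arguments.
Unset Strict Implicit.
Unset Printing Implicit Defensive.
Import Order.TTheory GRing.Theory Num.Theory.
Import numFieldNormedType.Exports.
Local Open Scope classical_set_scope.
Local Open Scope ring_scope.

(** If [L] is regular, the value [f t] of a function [f] in [XL R L] depends only
    on the transition map induced by the word [t], hence finitely many words
    [v_i] sample every function of the space. So [XL R L] embeds linearly into a
    space of finite sequences, and the Euclidean norm of the sample is an
    equivalent uniformly convex norm. A space finitely representable in a
    finite-dimensional one is finite-dimensional, hence reflexive.

    The converse implications both pass through the following dichotomy, valid
    for the closed span of infinitely many distinct 0-1 valued functions
    ([zero_one_dichotomy]); for a nonregular language these are the indicators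
    of the infinitely many derivatives. Either there is an infinite staircase:
    a bounded sequence [x_k] and functionals [p_m] of norm at most 1 with
    [p_m x_k = 1] if [m <= k] and [p_m x_k = 0] otherwise; or, for every [n],
    there are [n] functions of norm at most 1 taking all [2 ^ n] patterns of
    signs at suitable words, so that they span a copy of l_1 of dimension [n].
    The dichotomy is a Ramsey argument. Along a homogeneous sequence of
    functions [f_j] and points [v_i], the matrix [f_j v_i] is a half-graph,
    which is a staircase, or it is constant off the diagonal. In the latter
    case, either no point makes a sequence of the [f_j] alternate [d] times
    between 0 and 1, and the partial sums of differences of consecutive
    functions are bounded and form a staircase; or all lengths of alternation
    occur along homogeneous sequences, and then all sign patterns occur.

    An infinite staircase contradicts reflexivity by interchanging two limits
    along an ultrafilter ([staircase_not_reflexive]). In the other case the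
    closed span of the Rademacher functions, which is l_1, is finitely
    representable in [XL R L], and it contains a staircase too
    ([shattering_not_superreflexive]). Sign patterns give finite staircases of
    every length, and these are incompatible with uniform convexity: repeatedly
    averaging dyadic blocks shrinks norms geometrically, while the functionals
    keep them bounded below ([staircases_not_uniformly_convex]). Together,
    superreflexivity implies regularity, which provides the uniformly convex
    norm directly. *)

(** * Independent families and bases *)

Definition independent (R : realType) (V : lmodType R) (n : nat)
    (y : 'I_n -> V) : Prop :=
  forall c : 'I_n -> R, \sum_(i < n) c i *: y i = 0 -> forall i, c i = 0.

Lemma wide_matrix_kernel (R : realType) (m n : nat) (A : 'M[R]_(m, n)) :
  (n < m)%N -> exists2 c : 'rV[R]_m, c != 0 & c *m A = 0.
Proof.
move=> nm; have : kermx A != 0.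
  rewrite -mxrank_eq0 mxrank_ker subn_eq0 -ltnNge.
  exact: leq_ltn_trans (rank_leq_col A) nm.
move=> /rowV0Pn[c /sub_kermxP cA c0]; by exists c.
Qed.

Lemma independent_leq_embedding (R : realType) (V : lmodType R) (m n : nat)
    (J : V -> 'rV[R]_n) (y : 'I_m -> V) :
  linear J -> (forall v, J v = 0 -> v = 0) -> independent y -> (m <= n)%N.
Proof.
move=> Jl J0 yi; rewrite leqNgt; apply/negP => nm.
pose Jm : {linear V -> 'rV[R]_n} := HB.pack J (GRing.isLinear.Build _ _ _ _ _ Jl).
have [c c0 cA] := wide_matrix_kernel (\matrix_i J (y i)) nm.
have : \sum_(i < m) c 0 i *: y i = 0.
  apply: J0; rewrite -[J]/(Jm : _ -> _) linear_sum -[RHS]cA mulmx_sum_row.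
  by apply: eq_bigr => i _; rewrite linearZ rowK.
move=> /yi c_eq0; move/eqP: c0; apply; apply/rowP => i; by rewrite c_eq0 mxE.
Qed.

Lemma independent_leq_span (R : realType) (V : lmodType R) (m n : nat)
    (s : 'I_n -> V) (y : 'I_m -> V) :
  (forall i, exists a : 'I_n -> R, y i = \sum_(j < n) a j *: s j) ->
  independent y -> (m <= n)%N.
Proof.
move=> /choice[a ya] yi; rewrite leqNgt; apply/negP => nm.
have [c c0 cA] := wide_matrix_kernel (\matrix_(i, j) a i j) nm.
have : \sum_(i < m) c 0 i *: y i = 0.
  under eq_bigr => i _ do rewrite ya scaler_sumr.
  rewrite exchange_big big1//= => j _.
  under eq_bigr => i _ do rewrite scalerA.
  rewrite -scaler_suml.
  have -> : \sum_(i < m) c 0 i * a i j = 0; last by rewrite scale0r.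
  have /rowP/(_ j) := cA; rewrite !mxE => cA0; rewrite -[RHS]cA0.
  by apply: eq_bigr => i _; rewrite mxE.
move=> /yi c_eq0; move/eqP: c0; apply; apply/rowP => i; by rewrite c_eq0 mxE.
Qed.

(** The bound [n] makes the cardinals of independent families in [E] have a
    maximum, and an independent family of maximal cardinal spans [E]: otherwise a
    vector outside its span could be added. *)
Lemma basis_exists (R : realType) (V : lmodType R) (E : set V) (n : nat) :
  (forall m (y : 'I_m -> V), (forall i, E (y i)) -> independent y -> (m <= n)%N) ->
  exists m (e : 'I_m -> V), [/\ independent e, forall i, E (e i) &
    forall x, E x -> exists c : 'I_m -> R, x = \sum_(i < m) c i *: e i].
Proof.
move=> En.
pose P m := `[< exists e : 'I_m -> V, (forall i, E (e i)) /\ independent e >].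
have P0 : exists m, P m.
  exists 0%N; apply/asboolP; exists (fun=> 0); by split=> [[]//|c _ []].
have Pn m : P m -> (m <= n)%N by move=> /asboolP[e [Ee]]; exact: En.
have [m /asboolP[e [Ee ei]] mmax] := ex_maxnP P0 Pn.
exists m, e; split=> // x Ex; apply: contrapT => xN.
have /mmax : P m.+1; last by rewrite ltnn.
apply/asboolP.
exists (fun i => oapp e x (unlift ord0 i)); split=> [i|c].
  by case: unliftP => [j _|_] /=.
rewrite big_ord_recl unlift_none /=.
under eq_bigr => i _ do rewrite liftK /=.
move=> c0.
have c00 : c ord0 = 0.
  apply/eqP/negPn/negP => cN; apply: xN.
  exists (fun i => - (c ord0)^-1 * c (lift ord0 i)).
  under eq_bigr => i _ do rewrite -scalerA.
  rewrite -scaler_sumr; move/eqP: c0; rewrite addr_eq0 => /eqP.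
  move/(congr1 (fun z => (c ord0)^-1 *: z)).
  by rewrite scalerA mulVf// scale1r scalerN scaleNr.
move: c0; rewrite c00 scale0r add0r => /ei cl i.
by case: (unliftP ord0 i) => [j ->|->].
Qed.

(** * Norms on finite-dimensional spaces *)

Lemma coord_le_mx_norm (R : realType) (n : nat) (v : 'rV[R]_n) i :
  `|v 0 i| <= `|v|.
Proof.
rewrite [leRHS]/Num.norm /= mx_normrE.
by apply/bigmax_geP; right => /=; exists (0, i).
Qed.

(** The map [a |-> |sum_j a_j e_j|] is continuous, so it attains its minimum on
    the compact unit sphere; this minimum is positive by independence, and
    homogeneity extends the bound to all [a]. *)
Lemma independent_norm_lower (R : realType) (V : normedModType R) (n : nat)
    (e : 'I_n -> V) : independent e ->
  exists2 c : R, 0 < c & forall a : 'I_n -> R, forall i,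
    c * `|a i| <= `|\sum_(j < n) a j *: e j|.
Proof.
case: n e => [|n] e ei; first by exists 1 => // a [].
pose f (v : 'rV[R]_n.+1) := `|\sum_(j < n.+1) v 0 j *: e j|.
pose A := [set v : 'rV[R]_n.+1 | `|v| = 1].
have fc : continuous f.
  suff cs : continuous (fun v : 'rV[R]_n.+1 => \sum_(j < n.+1) v 0 j *: e j).
    by move=> v; exact: (cvg_norm (cs v)).
  apply: continuous_big => [|j _ v]; first exact: add_continuous.
  by apply: (@cvgZ _ _ _ (nbhs v) _ (fun w : 'rV[R]_n.+1 => w 0 j) (fun=> e j));
    [exact: coord_continuous|exact: cvg_cst].
have A0 : A !=set0.
  exists (const_mx 1); apply/eqP; rewrite eq_le; apply/andP; split.
    rewrite [leLHS]/Num.norm /= mx_normrE; apply/bigmax_leP; split=> // i _.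
    by rewrite mxE normr1.
  by have := coord_le_mx_norm (const_mx 1 : 'rV[R]_n.+1) 0; rewrite mxE normr1.
have Ac : compact A.
  apply: bounded_closed_compact.
    by exists 1; split=> // M M1 v /= ->; exact: ltW.
  apply: (@closed_comp _ _ (fun v : 'rV[R]_n.+1 => `|v|) [set 1]).
    by move=> v _; exact: norm_continuous.
  exact: closed_eq.
have [v0 v0A v0min] := EVT_min_rV A0 Ac (continuous_subspaceT fc).
rewrite inE in v0A.
have fv0 : 0 < f v0.
  rewrite normr_gt0; apply/eqP => /ei v00.
  have : v0 = 0 by apply/rowP => i; rewrite v00 mxE.
  by move=> v0E; move: v0A; rewrite /A/= v0E normr0 => /eqP; rewrite eq_sym oner_eq0.
exists (f v0) => // a i.
pose v : 'rV[R]_n.+1 := \row_j a j.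
have [v_0|v_n0] := eqVneq v 0.
  have -> : a i = 0 by have /rowP/(_ i) := v_0; rewrite !mxE.
  by rewrite normr0 mulr0.
have v_gt0 : 0 < `|v| by rewrite normr_gt0.
have -> : \sum_(j < n.+1) a j *: e j = `|v| *: \sum_(j < n.+1) (`|v|^-1 *: v) 0 j *: e j.
  rewrite scaler_sumr; apply: eq_bigr => j _.
  by rewrite !mxE scalerA mulrA divff ?mul1r// gt_eqF.
rewrite normrZ normr_id mulrC; apply: ler_pM => //; first exact: ltW.
  by have := coord_le_mx_norm v i; rewrite mxE.
apply: v0min; rewrite inE /A /= normrZ normfV normr_id mulVf//.
by rewrite gt_eqF.
Qed.

(** * Finite representability from a dense subspace *)

Lemma lspan_sum (R : realType) (V : normedModType R) (S : set V) (n : nat)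
    (a : 'I_n -> R) (v : 'I_n -> V) :
  (forall i, lspan S (v i)) -> lspan S (\sum_(i < n) a i *: v i).
Proof.
have [S0 SD] := lspan_submod S.
move=> Sv; apply: big_ind => //.
  by move=> x y Sx Sy; rewrite -[x]scale1r; exact: SD.
by move=> i _; rewrite -[_ *: _]addr0; exact: SD.
Qed.

Lemma sub_lspan (R : realType) (V : normedModType R) (S : set V) :
  S `<=` lspan S.
Proof.
move=> v Sv; exists 1%N, (fun=> 1), (fun=> v); split=> //.
by rewrite big_ord1 scale1r.
Qed.

Lemma lspan_familyP (R : realType) (V : normedModType R) (n : nat)
    (s : 'I_n -> V) (x : V) :
  lspan [set` codom s] x <-> exists a : 'I_n -> R, x = \sum_(i < n) a i *: s i.
Proof.
split=> [[m [b [v [vs ->]]]]|[a ->]]; last first.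
  by apply: lspan_sum => i; apply: sub_lspan; exact: codom_f.
apply: (big_ind (fun x => exists a : 'I_n -> R, x = \sum_(i < n) a i *: s i)).
- by exists (fun=> 0); rewrite big1// => i _; rewrite scale0r.
- move=> _ _ [a ->] [a' ->]; exists (fun i => a i + a' i).
  by rewrite -big_split; apply: eq_bigr => i _; rewrite scalerDl.
- move=> i _; have /codomP[j ->] := vs i.
  exists (fun k => if k == j then b i else 0); rewrite (bigD1 j)//= eqxx big1 ?addr0//.
  by move=> k /negbTE ->; rewrite scale0r.
Qed.

Lemma findim_subspaceP (R : realType) (V : normedModType R) (E : set V) :
  findim_subspace E <-> exists n (s : 'I_n -> V), E = lspan [set` codom s].
Proof.
split=> [[s ->]|[n [s ->]]]; last by exists (codom s).
exists (size s), (tnth (in_tuple s)); congr lspan; apply/seteqP; split=> x /=.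
  by move=> /(tnthP (in_tuple s))[i ->]; exact: codom_f.
by move=> /codomP[i ->]; exact: mem_tnth.
Qed.

Lemma findim_subspace_basis (R : realType) (V : normedModType R) (E : set V) :
  findim_subspace E ->
  exists n (e : 'I_n -> V), independent e /\ E = lspan [set` codom e].
Proof.
move=> /findim_subspaceP[n [s ->]].
have [m [e [ei Ee eE]]] : exists m (e : 'I_m -> V), [/\ independent e,
    forall i, lspan [set` codom s] (e i) &
    forall x, lspan [set` codom s] x -> exists c : 'I_m -> R,
      x = \sum_(i < m) c i *: e i].
  apply: (@basis_exists R V _ n) => m y ys; apply: (independent_leq_span (s := s)).
  by move=> i; apply/lspan_familyP.
exists m, e; split=> //; apply/seteqP; split=> x.
  by move=> /eE; rewrite lspan_familyP.
by move=> /lspan_familyP[a ->]; exact: lspan_sum.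
Qed.

Lemma independent_coord (R : realType) (V : lmodType R) (n : nat)
    (e : 'I_n -> V) (a b : 'I_n -> R) : independent e ->
  \sum_(i < n) a i *: e i = \sum_(i < n) b i *: e i -> a = b.
Proof.
move=> ei ab; apply/funext => i; apply/subr0_eq.
apply: (ei (fun i => a i - b i)).
under eq_bigr => j _ do rewrite scalerBl.
by rewrite sumrB ab subrr.
Qed.

(** Small perturbations of a basis. A finite-dimensional subspace of [Y] has a
    basis [b]; approximating each [b i] by [d i] in [D] changes the norm of a
    linear combination only by a small multiple of itself, because the
    coefficients are controlled by the norm ([independent_norm_lower]). The
    isometric copy [x] of [d] in [X] therefore gives an almost isometry. *)
Lemma finitely_representable_dense (R : realType) (Y X : normedModType R)
    (D : set Y) :
  (forall y (e : R), 0 < e -> exists2 d, D d & `|y - d| <= e) ->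
  (forall n (d : 'I_n -> Y), (forall i, D (d i)) ->
    exists x : 'I_n -> X, forall a : 'I_n -> R,
      `|\sum_(i < n) a i *: x i| = `|\sum_(i < n) a i *: d i|) ->
  finitely_representable Y X.
Proof.
move=> Ddense Diso E /findim_subspace_basis[n [b [bi ->]]] e e0.
have [c c0 cb] := independent_norm_lower bi.
(* With this choice, (1 + eta) / (1 - eta) < 1 + e. *)
pose eta := e / (3 + e).
have e3 : 0 < 3 + e by rewrite addr_gt0.
have eta0 : 0 < eta by rewrite divr_gt0.
have eta1 : eta < 1 by rewrite ltr_pdivrMr// mul1r ltrDr.
have eta_e : (1 + eta) * (1 - eta)^-1 < 1 + e.
  have etaE : eta * (3 + e) = e by rewrite divfK ?gt_eqF.
  rewrite ltr_pdivrMr ?subr_gt0//; lra.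
(* The successor keeps the denominator nonzero when the basis is empty. *)
pose del := eta * c / n.+1%:R.
have del0 : 0 < del by rewrite divr_gt0// mulr_gt0.
have /choice[d bd] : forall i : 'I_n, exists d, D d /\ `|b i - d| <= del.
  by move=> i; have [d] := Ddense (b i) _ del0; exists d.
have [x xd] := Diso n d (fun i => (bd i).1).
have close a : `|\sum_(i < n) a i *: b i - \sum_(i < n) a i *: d i| <=
    eta * `|\sum_(i < n) a i *: b i|.
  rewrite -sumrB; apply: le_trans (ler_norm_sum _ _ _) _.
  apply: le_trans (_ : \sum_(i < n) (del / c * `|\sum_(i < n) a i *: b i|) <= _).
    apply: ler_sum => i _; rewrite -scalerBr normrZ.
    rewrite mulrAC -mulrA [leRHS]mulrC; apply: ler_pM => //; last exact: (bd i).2.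
    by rewrite ler_pdivlMr// mulrC cb.
  rewrite sumr_const card_ord -[_ *+ _]mulr_natr mulrAC ler_wpM2r//.
  have -> : del / c * n%:R = eta * (n%:R / n.+1%:R).
    by rewrite /del; field; rewrite (gt_eqF c0) andbT addrC natr1 pnatr_eq0.
  apply: ler_piMr; first exact: ltW.
  by rewrite ler_pdivrMr// mul1r ler_nat.
have upper a : `|\sum_(i < n) a i *: x i| <= (1 + eta) * `|\sum_(i < n) a i *: b i|.
  rewrite xd mulrDl mul1r -[X in `|X|](subrK (\sum_(i < n) a i *: b i)) addrC.
  rewrite (le_trans (ler_normD _ _))// lerD2l distrC; exact: close.
have lower a : (1 - eta) * `|\sum_(i < n) a i *: b i| <= `|\sum_(i < n) a i *: x i|.
  rewrite xd mulrBl mul1r lerBlDr -[X in `|X| <= _](subrK (\sum_(i < n) a i *: d i)).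
  by rewrite addrC (le_trans (ler_normD _ _))// lerD2l; exact: close.
have xi : independent x.
  move=> a ax; apply: bi; apply/normr0_eq0/eqP; rewrite eq_le normr_ge0 andbT.
  have := lower a; rewrite ax normr0 pmulr_rle0// subr_gt0//.
have coords (W : normedModType R) (w : 'I_n -> W) : exists k : W -> 'I_n -> R,
    forall y, lspan [set` codom w] y -> y = \sum_(i < n) k y i *: w i.
  suff /choice[k kP] : forall y, exists a : 'I_n -> R,
      lspan [set` codom w] y -> y = \sum_(i < n) a i *: w i by exists k.
  move=> y; have [/lspan_familyP[a ->]|nw] := pselect (lspan [set` codom w] y).
    by exists a.
  by exists (fun=> 0).
have [kb kbP] := coords _ b; have [kx kxP] := coords _ x.
have kbE a : kb (\sum_(i < n) a i *: b i) = a.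
  apply: (independent_coord bi); rewrite -kbP//; apply/lspan_familyP; by exists a.
have kxE a : kx (\sum_(i < n) a i *: x i) = a.
  apply: (independent_coord xi); rewrite -kxP//; apply/lspan_familyP; by exists a.
pose T y := \sum_(i < n) kb y i *: x i.
pose U z := \sum_(i < n) kx z i *: b i.
exists (lspan [set` codom x]), T, U; split.
- by exists (codom x).
- split.
  + move=> a _ _ /lspan_familyP[u ->] /lspan_familyP[v ->].
    have -> : a *: \sum_(i < n) u i *: b i + \sum_(i < n) v i *: b i =
        \sum_(i < n) (a * u i + v i) *: b i.
      rewrite scaler_sumr -big_split; apply: eq_bigr => i _ /=.
      by rewrite scalerA scalerDl.
    rewrite /T !kbE scaler_sumr -big_split; apply: eq_bigr => i _ /=.
    by rewrite scalerA scalerDl.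
  + by move=> y _; apply/lspan_familyP; exists (kb y).
  + by move=> z _; apply/lspan_familyP; exists (kx z).
  + by move=> y /[!inE] yb; rewrite /U kxE -kbP.
  + by move=> z /[!inE] zx; rewrite /T kbE -kxP.
- have T1 : (opnorm (lspan [set` codom b]) T <= (1 + eta)%:E)%E.
    apply: opnorm_le => y yb y1; apply: le_trans (upper (kb y)) _.
    by rewrite -kbP// ler_piMr// addr_ge0// ltW.
  have U1 : (opnorm (lspan [set` codom x]) U <= ((1 - eta)^-1)%:E)%E.
    apply: opnorm_le => z zx z1; rewrite -[leRHS]mul1r ler_pdivlMr ?subr_gt0//.
    by rewrite mulrC; apply: le_trans (lower (kx z)) _; rewrite -kxP.
  have op0 (V W : normedModType R) (S : set V) (f : V -> W) :
      (0 <= opnorm (lspan S) f)%E.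
    apply: le_trans (opnorm_ub f (x := 0) _ _); rewrite ?normr0 ?lee_fin//.
    exact: (lspan_submod S).1.
  exact: le_lt_trans (lee_pmul (op0 _ _ _ _) (op0 _ _ _ _) T1 U1) _.
Qed.

(** * Finite-dimensional spaces are reflexive *)

Lemma dual_sum (R : realType) (V : normedModType R) (f : dual V) (n : nat)
    (a : 'I_n -> R) (v : 'I_n -> V) :
  f (\sum_(i < n) a i *: v i) = \sum_(i < n) a i * f (v i).
Proof.
pose g : {linear V -> R^o} :=
  HB.pack (dual_fun f) (GRing.isLinear.Build _ _ _ _ _ (dual_linear f)).
rewrite -[dual_fun f]/(g : _ -> _) linear_sum.
by apply: eq_bigr => i _; rewrite linearZ.
Qed.

Lemma dual_sumE (R : realType) (V : normedModType R) (n : nat)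
    (a : 'I_n -> R) (f : 'I_n -> dual V) (x : V) :
  (\sum_(i < n) a i *: f i : dual V) x = \sum_(i < n) a i * f i x.
Proof.
have el : linear (fun g : dual V => g x : R^o) by [].
pose ev : {linear dual V -> R^o} :=
  HB.pack (fun g : dual V => g x : R^o) (GRing.isLinear.Build _ _ _ _ _ el).
rewrite -[LHS]/(ev _) linear_sum.
by apply: eq_bigr => i _; rewrite linearZ.
Qed.

Lemma finite_dimensionalP (R : realType) (V : normedModType R) :
  finite_dimensional V <-> exists n (s : 'I_n -> V),
    forall x, exists a : 'I_n -> R, x = \sum_(i < n) a i *: s i.
Proof.
rewrite /finite_dimensional findim_subspaceP; split=> -[n [s sV]]; exists n, s.
  by move=> x; apply/lspan_familyP; rewrite -sV.
by apply/seteqP; split=> x // _; apply/lspan_familyP.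
Qed.

Lemma finite_dimensional_embedding (R : realType) (V : normedModType R) (n : nat)
    (J : V -> 'rV[R]_n) :
  linear J -> (forall v, J v = 0 -> v = 0) -> finite_dimensional V.
Proof.
move=> Jl J0; apply/finite_dimensionalP.
have [m [e [_ _ eV]]] : exists m (e : 'I_m -> V), [/\ independent e,
    forall i, [set: V] (e i) &
    forall x, [set: V] x -> exists c : 'I_m -> R, x = \sum_(i < m) c i *: e i].
  by apply: (@basis_exists R V _ n) => m y _; exact: (independent_leq_embedding Jl J0).
by exists m, e => x; exact: eV.
Qed.

(** Evaluation at a spanning family [s] embeds the dual into a space of finite
    sequences, so the dual has a finite basis [f]. The matrix [F] of values
    [f j (s i)] has independent rows, hence a right inverse, and this solves the
    linear system [f j x = phi (f j)] for [x] in the span of [s]. *)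
Lemma finite_dimensional_reflexive (R : realType) (V : normedModType R) :
  finite_dimensional V -> reflexive_space V.
Proof.
move=> /finite_dimensionalP[n [s sV]] phi.
pose J (f : dual V) : 'rV[R]_n := \row_i f (s i).
have Jl : linear J by move=> a f g; apply/rowP => i; rewrite !mxE.
have J0 f : J f = 0 -> f = 0.
  move=> Jf; apply: val_inj; apply/funext => x; have [a ->] := sV x.
  rewrite -[LHS]/(f _) dual_sum big1// => i _.
  by have /rowP/(_ i) := Jf; rewrite !mxE => ->; rewrite mulr0.
have [k [f [fi _ fV]]] : exists k (f : 'I_k -> dual V), [/\ independent f,
    forall i, [set: dual V] (f i) &
    forall g, [set: dual V] g -> exists c : 'I_k -> R, g = \sum_(i < k) c i *: f i].
  by apply: (@basis_exists R _ _ n) => m y _; exact: (independent_leq_embedding Jl J0).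
pose F := \matrix_(j < k) J (f j).
have Ffree : row_free F.
  rewrite -kermx_eq0; apply/negPn/negP => /rowV0Pn[c /sub_kermxP cF /eqP]; apply.
  apply/rowP => j; rewrite mxE; apply: (fi (fun j => c 0 j)); apply: J0.
  pose Jm : {linear dual V -> 'rV[R]_n} :=
    HB.pack J (GRing.isLinear.Build _ _ _ _ _ Jl).
  rewrite -[J]/(Jm : _ -> _) linear_sum -[RHS]cF mulmx_sum_row.
  by apply: eq_bigr => i _; rewrite linearZ rowK.
pose a := pinvmx F *m \col_j phi (f j).
have Fa : F *m a = \col_j phi (f j) by rewrite mulmxA mulmxVp// mul1mx.
exists (\sum_(i < n) a i 0 *: s i) => g.
have [c ->] := fV g I; rewrite dual_sum dual_sumE; apply: eq_bigr => j _.
congr (_ * _); rewrite dual_sum.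
have /matrixP/(_ j 0) := Fa; rewrite !mxE => <-.
by apply: eq_bigr => i _; rewrite !mxE mulrC.
Qed.

(** An independent family of [Y] is sent by the almost isometry on its span to an
    independent family of [X], so its cardinal is at most the dimension of
    [X]. *)
Lemma finite_dimensional_representable (R : realType) (Y X : normedModType R) :
  finite_dimensional X -> finitely_representable Y X -> finite_dimensional Y.
Proof.
move=> /finite_dimensionalP[n [s sX]] YX; apply/finite_dimensionalP.
have [m [e [_ _ eV]]] : exists m (e : 'I_m -> Y), [/\ independent e,
    forall i, [set: Y] (e i) &
    forall x, [set: Y] x -> exists c : 'I_m -> R, x = \sum_(i < m) c i *: e i].
  apply: (@basis_exists R Y _ n) => m y _ yi.
  pose E := lspan [set` codom y].
  have [|G [T [U [_ [Tl _ _ TU _] _]]]] := YX E _ 1 ltr01; first by exists (codom y).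
  have [E0 ED] := lspan_submod [set` codom y].
  have Ey i : E (y i) by apply: sub_lspan; exact: codom_f.
  have T0 : T 0 = 0.
    by have := Tl (-1) 0 0 E0 E0; rewrite scaler0 addr0 scaleN1r addNr.
  have Tsum (r : seq 'I_m) (c : 'I_m -> R) :
      E (\sum_(i <- r) c i *: y i) /\
      T (\sum_(i <- r) c i *: y i) = \sum_(i <- r) c i *: T (y i).
    elim: r => [|i r [Er Tr]]; first by rewrite !big_nil.
    rewrite !big_cons; split; first exact: (ED _ _ _ (Ey i) Er).
    by rewrite (Tl _ _ _ (Ey i) Er) Tr.
  apply: (independent_leq_span (s := s) (y := T \o y)) => // c cT; apply: yi.
  have [Ec Tc] := Tsum (index_enum _) c.
  have U0 : U 0 = 0 by rewrite -T0; apply: TU; exact/mem_set.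
  rewrite -[LHS]TU; last exact/mem_set.
  by rewrite Tc -[RHS]U0; congr U; exact: cT.
by exists m, e => x; exact: eV.
Qed.

(** * Staircases and reflexivity *)

(** The index set is everything for an infinite staircase, and an initial
    segment for a finite one. *)
Definition staircase (R : realType) (V : normedModType R) (I : set nat) (A : R)
    (x : nat -> V) (p : nat -> V -> R^o) : Prop :=
  [/\ forall k, I k -> `|x k| <= A, forall m, linear (p m),
      forall m z, `|p m z| <= `|z| &
      forall m k, I m -> I k -> p m (x k) = (m <= k)%:R].

Lemma exists_free_ultrafilter :
  exists U : set_system nat, UltraFilter U /\ \oo `<=` U.
Proof. exact: ultraFilterLemma. Qed.

Lemma ultra_pushforward (S T : Type) (F : set_system S) (f : S -> T) :
  UltraFilter F -> UltraFilter (f @ F).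
Proof.
move=> UF; split=> [|G PG FG]; first exact: fmap_proper_filter.
rewrite eqEsubset; split=> // A GA.
have [//|FA] := in_ultra_setVsetC (f @^-1` A) UF.
by have /filter_ex[? []] : G (A `&` ~` A) by apply: filterI => //; exact: FG.
Qed.

Lemma ultra_bounded_cvg (R : realType) (U : set_system nat) (u : nat -> R) (M : R) :
  UltraFilter U -> (forall n, `|u n| <= M) -> cvg (u @ U).
Proof.
move=> UU uM.
have uMM : (u @ U) `[- M, M]%classic.
  by apply: (@filterE _ U) => n /=; rewrite in_itv/= -ler_norml.
have := @segment_compact R (- M) M; rewrite compact_ultra.
by move=> /(_ (u @ U) (ultra_pushforward u UU) uMM)[l [_ ul]]; apply/cvg_ex; exists l.
Qed.

Lemma ultra_lim_le (R : realType) (U : set_system nat) (u : nat -> R) (M : R) :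
  UltraFilter U -> (forall n, `|u n| <= M) -> `|lim (u @ U)| <= M.
Proof.
move=> UU uM; have cu := ultra_bounded_cvg UU uM.
apply: (closed_cvg (fun x : R => x <= M)) (cvg_norm cu); first exact: closed_le.
exact: nearW.
Qed.

Lemma dual_of_bounded (R : realType) (V : normedModType R) (g : V -> R^o) (M : R) :
  linear g -> (forall x, `|g x| <= M * `|x|) -> g \in dual_pred V.
Proof.
move=> gl gM; apply/asboolP; split=> //.
pose h : {linear V -> R^o} := HB.pack g (GRing.isLinear.Build _ _ _ _ _ gl).
apply: (@bounded_linear_continuous _ _ _ h); apply/linear_boundedP.
exists M; split=> [|r Mr x]; first exact: num_real.
by apply: le_trans (gM x) _; rewrite ler_wpM2r// ltW.
Qed.

(** Grothendieck's double limit criterion. Along a free ultrafilter, the [x k]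
    define an element [phi] of the bidual and the [p m] an element [q] of the
    dual. If [phi] were evaluation at [z], then [p m z], the limit of
    [p m (x k)] in [k], would be 1 for all [m], so [q z = 1]; but [q z] is also
    [phi q], the limit of [q (x k)] in [k], and [q (x k) = 0] for all [k]. *)
Lemma staircase_not_reflexive (R : realType) (V : normedModType R) (A : R)
    (x : nat -> V) (p : nat -> V -> R^o) :
  staircase setT A x p -> ~ reflexive_space V.
Proof.
move=> [xA pl p1 px] Vr.
have [U [UU Uoo]] := exists_free_ultrafilter.
have p_dual m : p m \in dual_pred V.
  by apply: (dual_of_bounded (M := 1)) => // z; rewrite mul1r.
have pcvg z : cvg (p m z @[m --> U]) by exact: ultra_bounded_cvg (fun m => p1 m z).
pose q z : R^o := lim (p m z @[m --> U]).
have q_dual : q \in dual_pred V.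
  apply: (dual_of_bounded (M := 1)) => [a y z|z]; last first.
    by rewrite mul1r; exact: ultra_lim_le.
  apply: cvg_lim => //=.
  under eq_fun => m do rewrite pl.
  by apply: cvgD; [apply: cvgZ; [exact: cvg_cst|exact: pcvg]|exact: pcvg].
have fx (f : dual V) k : `|f (x k)| <= A * `|f|.
  have A0 : 0 <= A by apply: le_trans (xA 0%N I).
  have [A_0|A_n0] := eqVneq A 0.
    have := xA k I; rewrite A_0 normr_le0 => /eqP ->; rewrite mul0r.
    by have := dual_scale f 0 0; rewrite scale0r mul0r => ->; rewrite normr0.
  have : `|f (A^-1 *: x k)| <= `|f|.
    apply: dual_norm_ub1; rewrite normrZ normfV ger0_norm// mulrC ler_pdivrMr ?mul1r ?xA//.
    by rewrite lt_neqAle eq_sym A_n0.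
  rewrite dual_scale normrM normfV (ger0_norm A0) mulrC ler_pdivrMr 1?mulrC//.
  by rewrite lt_neqAle eq_sym A_n0.
have fcvg (f : dual V) : cvg (f (x k) @[k --> U]) by exact: ultra_bounded_cvg (fx f).
pose phi (f : dual V) : R^o := lim (f (x k) @[k --> U]).
have phi_dual : phi \in dual_pred (dual V).
  apply: (dual_of_bounded (M := A)) => [a f g|f]; last exact: ultra_lim_le.
  apply: cvg_lim => //=.
  by apply: cvgD; [apply: cvgZ; [exact: cvg_cst|exact: fcvg]|exact: fcvg].
have [z zphi] := Vr (Dual phi_dual).
have eventually_cst (u : nat -> R) N l : (forall n, (N <= n)%N -> u n = l) ->
    lim (u @ U) = l.
  move=> ul; apply: cvg_lim => //; apply: (@cvg_trans _ (u @ \oo)).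
    by move=> B; exact: Uoo.
  by apply: cvg_near_cst; exists N.
have pz m : p m z = 1.
  rewrite -[LHS]/(Dual (p_dual m) z) -zphi.
  by apply: (@eventually_cst _ m) => k mk; rewrite /= px// mk.
have qz : q z = 1 by apply: (@eventually_cst _ 0%N) => m _; rewrite pz.
have := zphi (Dual q_dual); rewrite /= qz => q1.
have : phi (Dual q_dual) = 0.
  apply: (@eventually_cst _ 0%N) => k _ /=.
  by apply: (@eventually_cst _ k.+1) => m km; rewrite px// leqNgt km.
by rewrite q1 => /eqP; rewrite oner_eq0.
Qed.

(** Half the difference of two evaluations reads off the tail of the indices:
    the pattern of [t0] is constantly 1, that of [t m] is -1 exactly from
    [m] on. *)
Lemma shattering_staircase (R : realType) (V : normedModType R) (T : Type)
    (ev : T -> V -> R^o) (I : set nat) (x : nat -> V) :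
  (forall t, linear (ev t)) -> (forall t z, `|ev t z| <= `|z|) ->
  (forall k, `|x k| <= 1) ->
  (forall e : nat -> bool, exists t, forall k, I k -> ev t (x k) = (-1) ^+ e k) ->
  exists p : nat -> V -> R^o, staircase I 1 x p.
Proof.
move=> evl ev1 x1 sh.
have [t0 t0P] := sh xpred0.
have /choice[t tP] : forall m, exists t, forall k, I k -> ev t (x k) = (-1) ^+ (m <= k)%N.
  by move=> m; exact: sh (leq m).
exists (fun m z => 2^-1 * (ev t0 z - ev (t m) z)); split.
- by move=> k _; exact: x1.
- move=> m a y z; rewrite /= !evl.
  by rewrite -[a *: (_ * _)]/(a * (_ * _)) -![a *: ev _ _]/(a * _); ring.
- move=> m z; rewrite normrM ger0_norm// ler_pdivrMl// mulr_natl mulr2n.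
  by rewrite (le_trans (ler_normB _ _))// lerD.
- move=> m k Im Ik; rewrite t0P// tP// expr0.
  by case: (m <= k)%N; rewrite ?expr1 ?expr0 ?opprK ?subrr ?mulr0// mulVf.
Qed.

(** * Rademacher functions *)

(** The lower bound comes from the point whose pattern is that of the signs of
    the coefficients. *)
Lemma shattering_l1_norm (R : realType) (V : normedModType R) (T : Type)
    (ev : T -> V -> R^o) (n : nat) (y : nat -> V) (a : nat -> R) :
  (forall t, linear (ev t)) -> (forall t z, `|ev t z| <= `|z|) ->
  (forall k, `|y k| <= 1) ->
  (forall e : nat -> bool, exists t, forall k, (k < n)%N -> ev t (y k) = (-1) ^+ e k) ->
  `|\sum_(k < n) a k *: y k| = \sum_(k < n) `|a k|.
Proof.
move=> evl ev1 y1 sh; apply/eqP; rewrite eq_le; apply/andP; split.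
  apply: le_trans (ler_norm_sum _ _ _) _; apply: ler_sum => k _.
  by rewrite normrZ ler_piMr.
have [t tP] := sh (fun k => a k < 0).
apply: le_trans (ev1 t _).
pose g : {linear V -> R^o} := HB.pack (ev t) (GRing.isLinear.Build _ _ _ _ _ (evl t)).
rewrite -[ev t]/(g : _ -> _) linear_sum.
apply: le_trans (ler_norm _); apply: ler_sum => k _.
by rewrite linearZ /= tP// [leRHS]mulrC -normrEsign.
Qed.

Lemma lspan_rangeP (R : realType) (V : normedModType R) (s : nat -> V) (x : V) :
  lspan (range s) x -> exists (b : nat -> R) (m : nat), forall n, (m <= n)%N ->
    x = \sum_(k < n) b k *: s k.
Proof.
move=> [l [c [v [vs ->]]]].
apply: (big_ind (fun x => exists (b : nat -> R) (m : nat), forall n, (m <= n)%N ->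
    x = \sum_(k < n) b k *: s k)).
- by exists (fun=> 0), 0%N => n _; rewrite big1// => k _; rewrite scale0r.
- move=> x1 x2 [b1 [m1 x1E]] [b2 [m2 x2E]].
  exists (fun k => b1 k + b2 k), (maxn m1 m2) => n; rewrite geq_max => /andP[m1n m2n].
  rewrite (x1E n)// (x2E n)// -big_split; apply: eq_bigr => k _.
  by rewrite scalerDl.
- move=> i _; have [j _ <-] := vs i.
  exists (fun k => if k == j then c i else 0), j.+1 => n jn.
  rewrite (bigD1 (Ordinal jn))//= eqxx big1 ?addr0// => k.
  by rewrite -val_eqE /= => /negbTE ->; rewrite scale0r.
Qed.

Lemma rademacher_subproof (R : realType) (k : nat) :
  (fun t : nat -> bool => (-1) ^+ t k : R^o) \in linfty_pred R (nat -> bool).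
Proof. by apply/asboolP; exists 1 => t; rewrite normr_sign. Qed.

Definition rademacher (R : realType) (k : nat) : linfty R (nat -> bool) :=
  Linfty (rademacher_subproof R k).

(** This is l_1, realized inside a space of bounded functions. *)
Definition rademacher_space (R : realType) : completeNormedModType R :=
  clspan (range (@rademacher R)).

Lemma mem_clspan (R : realType) (V : normedModType R) (S : set V) (v : V) :
  S v -> v \in clspan_pred S.
Proof. by move=> Sv; apply/asboolP/subset_closure; exact: sub_lspan. Qed.

Lemma clspan_linear (R : realType) (V : normedModType R) (S : set V) (W : lmodType R)
    (g : V -> W) : linear g -> linear (fun z : clspan S => g (clspan_val z)).
Proof. by move=> gl a y z; rewrite /= gl. Qed.

Lemma linfty_eval_linear (R : realType) (T : Type) (t : T) :
  linear (fun f : linfty R T => f t).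
Proof. by []. Qed.

Lemma clspan_dense (R : realType) (V : normedModType R) (s : nat -> V)
    (sS : forall k, s k \in clspan_pred (range s)) (y : clspan (range s)) (e : R) :
  0 < e -> exists2 d, lspan (range (fun k => Clspan (sS k))) d & `|y - d| <= e.
Proof.
move=> e0; have /asboolP/(_ (ball (clspan_val y) e)) := clspan_valP y.
case; first exact: nbhsx_ballx.
move=> v [/lspan_rangeP[b [m bE]]]; rewrite (bE m)// -ball_normE => yd.
exists (\sum_(k < m) b k *: Clspan (sS k)).
  by apply: lspan_sum => k; apply: sub_lspan; exists (k : nat).
rewrite clspan_normE; apply: ltW; move: yd; rewrite /ball_ /=.
have vl : linear (@clspan_val R V (range s)) by [].
pose g : {linear clspan (range s) -> V} :=
  HB.pack (@clspan_val R V (range s)) (GRing.isLinear.Build _ _ _ _ _ vl).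
have gd : g (\sum_(k < m) b k *: Clspan (sS k)) = \sum_(k < m) b k *: s k.
  by rewrite linear_sum; apply: eq_bigr => k _; rewrite linearZ.
congr (`|_| < _); rewrite -[RHS]/(g (y - _)) linearB gd; by [].
Qed.

(** By [shattering_l1_norm], a linear combination of Rademacher functions and the
    same combination of a shattered family both have the l_1 norm of the
    coefficients as norm. So the span of the Rademacher functions embeds
    isometrically, by finite pieces, in [X], whereas its closure contains a
    staircase and is not reflexive. *)
Lemma shattering_not_superreflexive (R : realType) (X : normedModType R) (T : Type)
    (ev : T -> X -> R^o) :
  (forall t, linear (ev t)) -> (forall t z, `|ev t z| <= `|z|) ->
  (forall n, exists2 y : nat -> X, forall k, `|y k| <= 1 &
    forall e : nat -> bool, exists t, forall k, (k < n)%N -> ev t (y k) = (-1) ^+ e k) ->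
  ~ superreflexive X.
Proof.
move=> evl ev1 sh /(_ (rademacher_space R)).
pose rS k : rademacher R k \in clspan_pred (range (@rademacher R)) :=
  mem_clspan (imageP _ I).
pose r k : rademacher_space R := Clspan (rS k).
pose evY (t : nat -> bool) (z : rademacher_space R) : R^o :=
  linfty_fun (clspan_val z) t.
have evYl t : linear (evY t).
  exact: clspan_linear (@linfty_eval_linear R _ t).
have evY1 t z : `|evY t z| <= `|z| by exact: sup_norm_ub.
have r1 k : `|r k| <= 1.
  by apply: sup_norm_le => // t /=; rewrite normr_sign.
have Ynr : ~ reflexive_space (rademacher_space R).
  have [|p /staircase_not_reflexive//] :=
    @shattering_staircase R _ _ evY setT r evYl evY1 r1.
  by move=> e; exists e.
move=> YX; apply: Ynr; apply: YX.
apply: (finitely_representable_dense (D := lspan (range r))).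
  by move=> y e; exact: clspan_dense.
move=> n d dr.
have /choice[b /choice[m bm]] : forall i, exists b : nat -> R, exists m : nat,
    forall n, (m <= n)%N -> d i = \sum_(k < n) b k *: r k.
  by move=> i; exact: lspan_rangeP.
pose N := \max_i m i.
have dE i : d i = \sum_(k < N) b i k *: r k by apply: bm; exact: leq_bigmax.
have [y y1 ysh] := sh N.
exists (fun i => \sum_(k < N) b i k *: y k) => a.
have swap (V : lmodType R) (w : nat -> V) :
    \sum_(i < n) a i *: (\sum_(k < N) b i k *: w k) =
    \sum_(k < N) (\sum_(i < n) a i * b i k) *: w k.
  under eq_bigr => i _ do rewrite scaler_sumr.
  rewrite exchange_big; apply: eq_bigr => k _ /=.
  by rewrite scaler_suml; apply: eq_bigr => i _; rewrite scalerA.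
under [in RHS]eq_bigr => i _ do rewrite dE.
rewrite !swap (shattering_l1_norm (fun k => \sum_(i < n) a i * b i k) evl ev1 y1 ysh).
rewrite (shattering_l1_norm (fun k => \sum_(i < n) a i * b i k) evYl evY1 r1)//.
by move=> e; exists e.
Qed.

Lemma finitely_representable_refl (R : realType) (X : normedModType R) :
  finitely_representable X X.
Proof.
apply: (finitely_representable_dense (D := setT)).
  by move=> y e e0; exists y => //; rewrite subrr normr0 ltW.
by move=> n d _; exists d.
Qed.

(** * Staircases and uniform convexity *)

Lemma is_norm_basics (R : realType) (V : lmodType R) (N : V -> R) : is_norm N ->
  [/\ forall x, 0 <= N x, forall x, N (- x) = N x &
      forall x y, N (2^-1 *: (x + y)) <= (N x + N y) / 2].
Proof.
move=> [ND NZ N0].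
have NN x : N (- x) = N x by rewrite -scaleN1r NZ normrN1 mul1r.
split=> // [x|x y].
  have N00 : N 0 = 0 by have := NZ 0 0; rewrite scale0r normr0 mul0r.
  by have := ND x (- x); rewrite subrr NN N00; lra.
by rewrite NZ ger0_norm// mulrC ler_wpM2r.
Qed.

(** Uniform convexity passes from the unit sphere to balls. On the unit ball,
    either one of the two vectors is well inside, and the triangle inequality
    suffices; or both are within [h] of their normalizations, to which uniform
    convexity applies. *)
Lemma uniformly_convex_ball (R : realType) (V : lmodType R) (N : V -> R) (e : R) :
  is_norm N -> uniformly_convex N -> 0 < e ->
  exists2 d : R, 0 < d < 1 & forall (M : R) (x y : V), 0 < M ->
    N x <= M -> N y <= M -> e * M <= N (x - y) ->
    N (2^-1 *: (x + y)) <= (1 - d) * M.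
Proof.
move=> Nn Nuc e0; have [Nge0 NN Nmid] := is_norm_basics Nn.
have [ND NZ _] := Nn.
have [d0 d00 d0P] := Nuc (e / 2) (divr_gt0 e0 (ltr0Sn R 1)).
pose h := Num.min (e / 4) (Num.min (d0 / 2) (1 / 2)).
have h0 : 0 < h by rewrite !lt_min !divr_gt0.
have he : h <= e / 4 by rewrite ge_min lexx.
have hd : h <= d0 / 2 by rewrite !ge_min lexx orbT.
have h2 : h <= 1 / 2 by rewrite !ge_min lexx !orbT.
exists (h / 2); first by apply/andP; split; lra.
have unit x y : N x <= 1 -> N y <= 1 -> e <= N (x - y) ->
    N (2^-1 *: (x + y)) <= 1 - h / 2.
  move=> x1 y1 exy; have mxy := Nmid x y.
  have [xh|xh] := ltP (N x) (1 - h); first lra.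
  have [yh|yh] := ltP (N y) (1 - h); first lra.
  pose u z := (N z)^-1 *: z.
  have u1 z : 1 - h <= N z -> N (u z) = 1.
    move=> zh; have z0 : 0 < N z by lra.
    by rewrite NZ normfV gtr0_norm// mulVf// gt_eqF.
  have uz z : 1 - h <= N z -> N z <= 1 -> N (z - u z) <= h.
    move=> zh z1; have z0 : 0 < N z by lra.
    rewrite -[X in X - _]scale1r -scalerBl NZ.
    have -> : `|1 - (N z)^-1| = (N z)^-1 - 1.
      by rewrite distrC ger0_norm// subr_ge0 invf_ge1.
    by rewrite mulrBl mulVf ?gt_eqF//; lra.
  have uux := uz _ xh x1; have uuy := uz _ yh y1.
  have uuyN : N (u y - y) <= h by rewrite -opprB NN.
  have euv : e / 2 <= N (u x - u y).
    have : N (x - y) <= N (x - u x) + N (u x - u y) + N (u y - y).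
      apply: le_trans (_ : N (x - u x + (u x - u y)) + N (u y - y) <= _).
        by rewrite -[X in N X <= _](subrKA (u y)) -(subrKA (u x) x (- u y)) ND.
      by rewrite lerD2r ND.
    lra.
  have muv := d0P _ _ (u1 _ xh) (u1 _ yh) euv.
  have mm := Nmid (x - u x) (y - u y).
  have : N (2^-1 *: (x + y)) <=
      N (2^-1 *: (u x + u y)) + N (2^-1 *: (x - u x + (y - u y))).
    apply: le_trans (ND _ _); rewrite -scalerDr.
    by rewrite addrACA !subrKC.
  lra.
move=> M x y M0 xM yM exy.
have sc z : N z = M * N (M^-1 *: z).
  by rewrite NZ normfV gtr0_norm// mulrA divff ?mul1r// gt_eqF.
have le1 z : N z <= M -> N (M^-1 *: z) <= 1.
  by move=> zM; rewrite -(ler_pM2l M0) -sc mulr1.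
rewrite sc mulrC ler_pM2r// scalerA mulrC -scalerA scalerDr.
apply: unit; rewrite ?le1//.
by rewrite -scalerBr -(ler_pM2l M0) -sc mulrC.
Qed.

(** The mean of [x i] over the dyadic interval of the [i] with
    [j * 2 ^ k <= i < (j + 1) * 2 ^ k], computed by successive halving. *)
Fixpoint block_mean (R : realType) (V : lmodType R) (x : nat -> V) (k j : nat) : V :=
  if k is k'.+1 then
    2^-1 *: (block_mean x k' j.*2 + block_mean x k' j.*2.+1)
  else x j.

Lemma block_mean_staircase (R : realType) (V : normedModType R) (A : R) (n : nat)
    (x : nat -> V) (p : nat -> V -> R^o) (k j m : nat) :
  staircase [set i | (i < n)%N] A x p -> (m < n)%N -> (j.+1 * 2 ^ k <= n)%N ->
  ((m <= j * 2 ^ k)%N -> p m (block_mean x k j) = 1) /\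
  ((j.+1 * 2 ^ k <= m)%N -> p m (block_mean x k j) = 0).
Proof.
move=> [_ pl _ px] mn.
elim: k j => [|k IH] j.
  rewrite expn0 !muln1 => jn; rewrite /= px//; split=> [->//|].
  by rewrite leqNgt => /negbTE; rewrite ltnS => ->.
rewrite expnS [X in (X <= n)%N]mulnA [X in (m <= X)%N]mulnA [X in (X <= m)%N]mulnA !muln2.
move=> jn.
have E : (j.*2.+1 * 2 ^ k = j.*2 * 2 ^ k + 2 ^ k)%N by rewrite mulSn addnC.
have E2 : (j.+1.*2 * 2 ^ k = j.*2.+1 * 2 ^ k + 2 ^ k)%N by rewrite doubleS mulSn addnC.
have k0 : (0 < 2 ^ k)%N by rewrite expn_gt0.
have [|a1 a0] := IH j.*2; first by lia.
have [|b1 b0] := IH j.*2.+1; first by rewrite -doubleS.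
pose g : {linear V -> R^o} := HB.pack (p m) (GRing.isLinear.Build _ _ _ _ _ (pl m)).
rewrite /= -[p m]/(g : _ -> _) linearZ linearD /= -[_ *: _]/(2^-1 * (p m _ + p m _)).
split=> mj.
  by rewrite a1 ?b1; [lra|lia|lia].
by rewrite a0 ?b0; [lra|rewrite -doubleS|lia].
Qed.

(** Two adjacent block means are at distance at least 1, since the functional
    indexed by their common endpoint vanishes on one and is 1 on the other.
    Uniform convexity then makes the bound on the means of blocks of length
    [2 ^ k] decay geometrically in [k], whereas [p 0] is 1 on all of them. *)
Lemma staircases_not_uniformly_convex (R : realType) (V : normedModType R) (A : R)
    (N : V -> R) :
  (forall n, exists (x : nat -> V) (p : nat -> V -> R^o),
    staircase [set k | (k < n)%N] A x p) ->
  equivalent_norm N -> ~ uniformly_convex N.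
Proof.
move=> st [Nn [c [C [c0 C0 cNC]]]] Nuc.
have A0 : 0 < A.
  have [x [p [xA _ p1 px]]] := st 1%N.
  apply: lt_le_trans (xA 0%N _) => //; apply: lt_le_trans (p1 0%N _).
  by rewrite px// normr1.
pose M := C * A; have M0 : 0 < M by rewrite mulr_gt0.
have [d /andP[d0 d1] dP] := uniformly_convex_ball Nn Nuc (divr_gt0 c0 M0).
have d1' : 0 < 1 - d by rewrite subr_gt0.
suff [K] : exists K, (1 - d) ^+ K * M < c.
  apply/negP; rewrite -leNgt.
  have [x [p xp]] := st (2 ^ K)%N; have [xA pl p1 px] := xp.
  have Nb k j : (j.+1 * 2 ^ k <= 2 ^ K)%N -> N (block_mean x k j) <= (1 - d) ^+ k * M.
    elim: k j => [|k IH] j.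
      rewrite expn0 muln1 => jK; rewrite expr0 mul1r.
      by have /andP[_ /le_trans] := cNC (x j); apply; rewrite ler_pM2l//; exact: xA.
    rewrite expnS mulnA muln2 => jK.
    have E : (j.+1.*2 * 2 ^ k = j.*2.+1 * 2 ^ k + 2 ^ k)%N by rewrite doubleS mulSn addnC.
    have k0 : (0 < 2 ^ k)%N by rewrite expn_gt0.
    have j1K : (j.*2.+1 * 2 ^ k < 2 ^ K)%N by lia.
    have Mk : (1 - d) ^+ k * M <= M.
      apply: ler_piMl; first exact: ltW.
      by apply: exprn_ile1; apply: ltW; rewrite ?gtrBl.
    rewrite exprS -mulrA /=; apply: dP.
    - by rewrite mulr_gt0// exprn_gt0.
    - by apply: IH; exact: ltnW.
    - by apply: IH; rewrite -doubleS.
    apply: le_trans (_ : c <= _).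
      by rewrite mulrAC ler_pdivrMr// ler_pM2l.
    have [_ pa] := block_mean_staircase (j := j.*2) (k := k) xp j1K (ltnW j1K).
    have [pb _] := block_mean_staircase (j := j.*2.+1) (k := k) xp j1K jK.
    set a := block_mean x k j.*2 in pa *; set b := block_mean x k j.*2.+1 in pb *.
    have /andP[/(le_trans _)cN _] := cNC (a - b); apply: cN.
    rewrite ler_pMr//; apply: le_trans (p1 (j.*2.+1 * 2 ^ k)%N _).
    pose g : {linear V -> R^o} := HB.pack (p (j.*2.+1 * 2 ^ k)%N)
      (GRing.isLinear.Build _ _ _ _ _ (pl _)).
    rewrite -[p _]/(g : _ -> _) linearB /= pa// pb//.
    by rewrite sub0r normrN normr1.
  apply: le_trans (Nb K 0%N _); last by rewrite mul1n.
  have /andP[/(le_trans _)cN _] := cNC (block_mean x K 0%N); apply: cN.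
  rewrite ler_pMr//; apply: le_trans (p1 0%N _).
  have K0 : (0 < 2 ^ K)%N by rewrite expn_gt0.
  have KK : (1 * 2 ^ K <= 2 ^ K)%N by rewrite mul1n.
  have [pK _] := block_mean_staircase (j := 0%N) (k := K) xp K0 KK.
  by rewrite pK// normr1.
have : (1 - d) ^+ n @[n --> \oo] --> (0 : R).
  by apply: cvg_expr; rewrite ger0_norm ?ltW// gtrBl.
move=> /cvgrPdist_lt /(_ (c / M)); rewrite divr_gt0// => /(_ isT)[K _ KP].
exists K; have := KP K (leqnn K).
by rewrite /= sub0r normrN ger0_norm ?ltr_pdivlMr// exprn_ge0// ltW.
Qed.

(** * A Ramsey theorem from an ultrafilter *)

(** The property [P] of the extensions of [s] by [d] terms, each term being
    quantified by: for almost all [n] along [U]. *)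
Fixpoint large (U : set_system nat) (d : nat) (P : seq nat -> Prop)
    (s : seq nat) : Prop :=
  if d is d'.+1 then U [set n | large U d' P (rcons s n)] else P s.

Lemma large_or_not (U : set_system nat) (d : nat) (P : seq nat -> Prop) s :
  UltraFilter U -> large U d P s \/ large U d (fun t => ~ P t) s.
Proof.
move=> UU; elim: d s => [|d IH] s /=; first by have [] := pselect (P s); [left|right].
have [|UN] := in_ultra_setVsetC [set n | large U d P (rcons s n)] UU; first by left.
by right; apply: filterS UN => n /= nP; have [] := IH (rcons s n).
Qed.

Lemma ultra_bool (U : set_system nat) (b : nat -> bool) :
  UltraFilter U -> exists c, U [set n | b n = c].
Proof.
move=> UU; have [bU|bN] := in_ultra_setVsetC [set n | b n] UU; first by exists true.
by exists false; apply: filterS bN => n /= /negP/negbTE.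
Qed.

Lemma filter_seqI (T : eqType) (U : set_system nat) (r : seq T) (Q : T -> set nat) :
  Filter U -> (forall t, t \in r -> U (Q t)) ->
  U [set n | forall t, t \in r -> Q t n].
Proof.
move=> FU; elim: r => [|t r IH] QU; first by apply: filterE.
have Qt : U (Q t) by apply: QU; rewrite mem_head.
have Qr : U [set n | forall t, t \in r -> Q t n].
  by apply: IH => u ur; apply: QU; rewrite in_cons ur orbT.
apply: filterS2 Qt Qr => n /= nt nr u.
by rewrite in_cons => /orP[/eqP ->//|]; exact: nr.
Qed.

Lemma subseq_rconsP (t a : seq nat) (n : nat) : subseq t (rcons a n) ->
  subseq t a \/ exists2 t', subseq t' a & t = rcons t' n.
Proof.
move=> /subseqP[m]; rewrite size_rcons; case/lastP: m => // m b.
rewrite size_rcons => -[ma]; rewrite mask_rcons// => ->.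
case: b; last by left; rewrite cats0 mask_subseq.
by right; exists (mask m a); rewrite ?mask_subseq// cats1.
Qed.

Lemma sorted_subseq_iota (t : seq nat) (k : nat) :
  sorted ltn t -> (forall i, i \in t -> (i < k)%N) -> subseq t (iota 0 k).
Proof.
move=> ts tk.
suff -> : t = [seq i <- iota 0 k | i \in t] by exact: filter_subseq.
apply: (irr_sorted_eq ltn_trans ltnn) => //.
  by apply: sorted_filter; [exact: ltn_trans|exact: iota_ltn_sorted].
move=> i; rewrite mem_filter mem_iota /= add0n.
by apply/idP/andP => [it|[]//]; split=> //; exact: tk.
Qed.

(** A sequence is built greedily so that every subsequence [t] of length at most
    [d] of the part already chosen satisfies [large U (d - size t) P t]. Each
    such requirement on the next term holds along [U], and there are finitely
    many of them. *)
Lemma large_homogeneous (U : set_system nat) (d : nat) (P : seq nat -> Prop) :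
  UltraFilter U -> \oo `<=` U -> large U d P [::] ->
  exists2 sigma : nat -> nat, {homo sigma : i j / (i < j)%N} &
    forall t, sorted ltn t -> size t = d -> P (map sigma t).
Proof.
move=> UU Uoo Pd.
pose good a := forall t, subseq t a -> (size t <= d)%N -> large U (d - size t) P t.
have step a : exists n, good a -> all (fun b => b < n)%N a /\ good (rcons a n).
  have [ga|ga] := pselect (good a); last by exists 0%N.
  have Ua : U [set n | all (fun b => b < n)%N a].
    apply: Uoo; exists (\max_(b <- a) b).+1 => // n /= an; apply/allP => b ba.
    by apply: leq_ltn_trans an; exact: leq_bigmax_seq.
  pose Q t : set nat := [set n | (size t < d)%N ->
    large U (d - (size t).+1) P (rcons t n)].
  have UQ : U [set n | forall t,
      t \in [seq mask (val m) a | m : (size a).-tuple bool] -> Q t n].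
    apply: filter_seqI => t /mapP[m _ ->].
    have := ga _ (mask_subseq (val m) a); rewrite /Q; set u := mask _ _ => gu.
    have [ud|ud] := ltnP (size u) d; last by apply: filterE.
    move: gu => /(_ (ltnW ud)); rewrite -subSS subSn//=.
    by apply: filterS => n /= nP _; exact: nP.
  have [n [nQ na]] := filter_ex (filterI UQ Ua).
  exists n => _; split=> // t /subseq_rconsP[ta td|[t' t'a ->]]; first exact: ga.
  rewrite size_rcons => td; apply: nQ => //.
  have /subseqP[m ma ->] := t'a; apply/mapP.
  by exists (Tuple (introT eqP ma)); rewrite ?mem_enum.
have [nx nxP] := choice step.
pose fix A k := if k is k'.+1 then rcons (A k') (nx (A k')) else [::].
have Agood k : good (A k).
  elim: k => [t|k IH]; last by have [] := nxP _ IH.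
  by rewrite subseq0 => /eqP ->; rewrite subn0.
pose sigma k := nx (A k).
have AE k : A k = map sigma (iota 0 k).
  elim: k => // k IH.
  by rewrite -[in RHS]addn1 iotaD map_cat -IH add0n cats1.
exists sigma => [i j ij|t ts td].
  have [/allP/(_ (sigma i)) + _] := nxP _ (Agood j); apply.
  by rewrite AE map_f// mem_iota.
pose k := (\max_(i <- t) i).+1.
have tk : subseq t (iota 0 k).
  by apply: sorted_subseq_iota => // i it; rewrite ltnS; exact: leq_bigmax_seq.
have := Agood k (map sigma t); rewrite size_map td subnn; apply=> //.
by rewrite AE; exact: map_subseq.
Qed.

(** * Homogeneous sequences of 0-1 valued functions *)

(** Let [gU] be the pointwise limit of [g] along a free ultrafilter. Almost every
    [g n] differs from [gU] at some point [w n], while for fixed [i] almost all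
    [g j] agree with [gU] at [w i]; and the values [gU (w i)], as well as the
    limits in [j] of [g i (w j)], are constant for almost all [i]. *)
Lemma separated_subsequence (S : Type) (g : nat -> S -> bool) :
  (forall i j, i != j -> exists s, g i s <> g j s) ->
  exists (sigma : nat -> nat) (v : nat -> S) (eps eta : bool), forall i j,
    g (sigma j) (v i) = if (i < j)%N then eps else if i == j then ~~ eps else eta.
Proof.
move=> gd; have [U [UU Uoo]] := exists_free_ultrafilter.
have [s0 _] := gd 0%N 1%N isT.
have /choice[gU gUP] : forall s, exists c, U [set n | g n s = c].
  by move=> s; exact: ultra_bool.
have /choice[w wP] : forall n, exists s,
    (exists s', g n s' <> gU s') -> g n s <> gU s.
  move=> n; have [[s' ns']|nN] := pselect (exists s', g n s' <> gU s').
    by exists s'.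
  by exists s0 => /nN.
have ne : U [set n | g n (w n) <> gU (w n)].
  suff [m mP] : exists m, forall n, (m <= n)%N -> exists s, g n s <> gU s.
    by apply: Uoo; exists m => // n /mP; exact: wP.
  apply: contrapT => mN.
  (* Otherwise infinitely many of the functions would equal gU. *)
  have eqU m : exists2 n, (m <= n)%N & forall s, g n s = gU s.
    apply: contrapT => nN; apply: mN; exists m => n mn.
    apply: contrapT => sN; apply: nN; exists n => // s.
    by apply: contrapT => sne; apply: sN; exists s.
  have [n _ nU] := eqU 0%N; have [m nm mU] := eqU n.+1.
  have [|s] := gd n m; first by rewrite neq_ltn nm.
  by rewrite nU mU.
have [eps epsP] := ultra_bool (fun n => gU (w n)) UU.
have /choice[c cP] : forall i, exists b, U [set j | g i (w j) = b].
  by move=> i; exact: ultra_bool.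
have [eta etaP] := ultra_bool c UU.
(* The diagonal value at [i] is recorded in every pair starting with [i]. *)
pose P t := let i := nth 0%N t 0 in let j := nth 0%N t 1 in
  [/\ g j (w i) = eps, g i (w i) = ~~ eps & g i (w j) = eta].
have P2 : large U 2 P [::].
  apply: filterS3 ne epsP etaP => i /= ine ieps ieta.
  have := cP i; rewrite ieta; have := gUP (w i); rewrite ieps.
  apply: filterS2 => j /= jeps jeta; split=> //.
  by move: ine; rewrite ieps; case: (g i _) (eps) => [] [].
have [sigma _ sP] := large_homogeneous UU Uoo P2.
have sP2 i j : (i < j)%N -> P [:: sigma i; sigma j].
  by move=> ij; apply: (sP [:: i; j]); rewrite //= ij.
exists sigma, (w \o sigma), eps, eta => i j /=.
have [/sP2[]//|/sP2[]//|->] := ltngtP i j.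
by have [] := sP2 j j.+1 (leqnn _).
Qed.

Definition alternates (b : nat -> bool) (t : seq nat) : Prop :=
  forall l, (l < size t)%N -> b (nth 0%N t l) = odd l.

(** The jumps from [c] to [~~ c] inside the disjoint pairs [(2i, 2i+1)]
    concatenate to an alternating sequence. *)
Lemma jumps_alternate (b : nat -> bool) (c : bool) (k : nat) :
  exists t, [/\ sorted ltn t, forall i, i \in t -> (i < k.*2)%N,
    size t = (\sum_(i < k) ((b i.*2 == c) && (b i.*2.+1 == ~~ c))).*2%N &
    forall l, (l < size t)%N -> b (nth 0%N t l) = c (+) odd l].
Proof.
elim: k => [|k [t [ts tk tn tb]]]; first by exists [::]; rewrite big_ord0.
rewrite big_ord_recr /=; case: andP => [[/eqP b0 /eqP b1]|_]; last first.
  exists t; split=> //; last by rewrite addn0.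
  by move=> i /tk /leq_trans; apply; rewrite leq_double.
exists (t ++ [:: k.*2; k.*2.+1]); split.
- rewrite (sorted_pairwise ltn_trans) pairwise_cat; apply/and3P; split.
  + apply/allrelP => i j /tk ik.
    by rewrite !inE => /orP[] /eqP ->; rewrite // ltnW.
  + by rewrite -(sorted_pairwise ltn_trans).
  + by rewrite /= ltnS leqnn.
- move=> i; rewrite mem_cat !inE doubleS => /orP[/tk ik|/orP[] /eqP ->] //.
  by rewrite !ltnS ltnW// ltnW.
- by rewrite size_cat tn doubleD.
move=> l; rewrite size_cat nth_cat /= => lt.
have [/tb//|tl] := ltnP l (size t).
have : (l - size t < 2)%N by lia.
have -> : odd l = odd (l - size t).
  by rewrite oddB// tn odd_double addbF.
by case: (l - size t)%N => [|[|]] //= _; rewrite ?b0 ?b1 ?addbF// addbT.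
Qed.

(** The sum is the number of upward jumps minus the number of downward jumps in
    the pairs [(2i, 2i+1)]. More than [d] jumps of either kind would produce an
    alternating sequence of length [d.*2]; for downward jumps, it is found after
    removing the first term. *)
Lemma no_alternation_bound (R : realType) (b : nat -> bool) (d k : nat) :
  (forall t, sorted ltn t -> size t = d.*2 -> ~ alternates b t) ->
  `|\sum_(i < k) ((b i.*2.+1)%:R - (b i.*2)%:R) : R| <= d%:R.
Proof.
move=> bN.
pose J c := (\sum_(i < k) ((b i.*2 == c) && (b i.*2.+1 == ~~ c)))%N.
have -> : \sum_(i < k) ((b i.*2.+1)%:R - (b i.*2)%:R) = (J false)%:R - (J true)%:R :> R.
  rewrite /J !natr_sum -sumrB; apply: eq_bigr => i _.
  by case: (b i.*2.+1) (b i.*2) => [] [] /=; rewrite ?subrr ?subr0.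
have J0 : (J false <= d)%N.
  rewrite leqNgt; apply/negP => dJ.
  have [t [ts _ tn tb]] := jumps_alternate b false k.
  have dt : (d.*2 <= size t)%N by rewrite tn; move: dJ; rewrite /J; lia.
  apply: (bN (take d.*2 t)).
  - by apply: subseq_sorted ts; [exact: ltn_trans|exact: take_subseq].
  - exact: size_takel.
  - move=> l; rewrite size_takel// => ld; rewrite nth_take// tb//.
    exact: leq_trans dt.
have J1 : (J true <= d)%N.
  rewrite leqNgt; apply/negP => dJ.
  have [t [ts _ tn tb]] := jumps_alternate b true k.
  have dt : (d.*2.+1 <= size t)%N by rewrite tn; move: dJ; rewrite /J; lia.
  (* Dropping the leading 1 makes the alternation start with 0. *)
  have st : size (take d.*2 (behead t)) = d.*2.
    by apply: size_takel; rewrite size_behead; lia.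
  apply: (bN (take d.*2 (behead t))) => //.
  - apply: subseq_sorted ts; first exact: ltn_trans.
    rewrite -drop1; exact: subseq_trans (take_subseq _ _) (drop_subseq _ _).
  - move=> l; rewrite st => ld; rewrite nth_take// nth_behead tb//.
      by rewrite /= negbK.
    exact: leq_ltn_trans dt.
have j0 : (J false)%:R <= d%:R :> R by rewrite ler_nat.
have j1 : (J true)%:R <= d%:R :> R by rewrite ler_nat.
have p0 : 0 <= (J false)%:R :> R by [].
have p1 : 0 <= (J true)%:R :> R by [].
by rewrite ler_norml; apply/andP; split; lra.
Qed.

(** Each index [i < n] receives a block of five consecutive integers, of which an
    alternating sequence visits four. The two middle elements [5i+1] and [5i+2]
    are visited in any case, and starting at [5i] or at [5i+1] decides which of
    the two values 1-0 or 0-1 they take. *)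
Lemma alternation_shatters (S : Type) (f : nat -> S -> bool) (n : nat) :
  (forall t, sorted ltn t -> size t = n.*2.*2 ->
    exists s, alternates (fun i => f i s) t) ->
  forall e : nat -> bool, exists s, forall i, (i < n)%N ->
    f (5 * i).+1 s = e i /\ f (5 * i).+2 s = ~~ e i.
Proof.
move=> falt e.
(* The alternating sequence spends four terms in each block of five. *)
pose pos l := (5 * (l %/ 4) + l %% 4 + ~~ e (l %/ 4)%N)%N.
have [||s sP] := falt (mkseq pos n.*2.*2).
- apply/(sortedP 0%N) => l; rewrite size_mkseq => ln.
  rewrite !nth_mkseq//; last exact: ltnW.
  have l1 := divn_eq l.+1 4; have l0 := divn_eq l 4.
  have m1 := ltn_pmod l.+1 (isT : (0 < 4)%N); have m0 := ltn_pmod l (isT : (0 < 4)%N).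
  rewrite /pos; have [E|E] := eqVneq (l.+1 %/ 4)%N (l %/ 4)%N.
    by rewrite E; rewrite E in l1; lia.
  by case: (e _) (e _) => [] []; move: E l1 l0; lia.
- by rewrite size_mkseq.
exists s => i i_n.
have val l : (l < n.*2.*2)%N -> f (pos l) s = odd l.
  by move=> ln; have := sP l; rewrite size_mkseq nth_mkseq//; apply.
have posE r : (r < 4)%N -> pos (4 * i + r)%N = (5 * i + r + ~~ e i)%N.
  by move=> r4; rewrite /pos (mulnC 4) divnMDl// modnMDl divn_small// modn_small// addn0.
have oddE r : odd (4 * i + r) = odd r by rewrite oddD oddM.
have lt r : (r < 4)%N -> (4 * i + r < n.*2.*2)%N by lia.
have v r (r4 : (r < 4)%N) : f (5 * i + r + ~~ e i)%N s = odd r.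
  by rewrite -posE// val ?lt// oddE.
case: (e i) v => v; split.
- by have := v 1%N isT; rewrite addn0 addn1.
- by have := v 2%N isT; rewrite addn0 addn2.
- by have := v 0%N isT; rewrite addn0 addn1.
- by have := v 1%N isT; rewrite !addn1.
Qed.

(** * The dichotomy for 0-1 valued functions *)

(** The values of [f j], standing for [G (sigma j)], at the points [v i] with
    [j < i] decide. If they differ from the values for [i < j], the differences
    [f k.+1 - f 0] form a staircase at the [v m]. If they are equal to them, then
    up to a common sign the difference [f i.*2.+1 - f i.*2] is 1 at [v i.*2.+1]
    and 0 at the other [v m.*2.+1], also along subsequences, so that the partial
    sums of these differences form a staircase as soon as they are bounded.
    [no_alternation_bound] gives a bound unless, for every [d], almost all tuples
    of [d.*2] functions alternate at some point, and then [alternation_shatters]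
    applies. *)
Lemma zero_one_dichotomy (R : realType) (V : normedModType R) (S : Type)
    (ev : S -> V -> R^o) (g : nat -> S -> bool) (G : nat -> V) :
  (forall s, linear (ev s)) -> (forall s z, `|ev s z| <= `|z|) ->
  (forall z (M : R), 0 <= M -> (forall s, `|ev s z| <= M) -> `|z| <= M) ->
  (forall i s, ev s (G i) = (g i s)%:R) ->
  (forall i j, i != j -> exists s, g i s <> g j s) ->
  (exists A (x : nat -> V) (p : nat -> V -> R^o), staircase setT A x p) \/
  (forall n, exists2 y : nat -> V, forall k, `|y k| <= 1 &
    forall e : nat -> bool, exists t, forall k, (k < n)%N -> ev t (y k) = (-1) ^+ e k).
Proof.
move=> evl ev1 evN evG gd.
have evB s y z : ev s (y - z) = ev s y - ev s z.
  by rewrite -[y - z]addrC -scaleN1r evl scaleN1r addrC.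
have evZ s a z : ev s (a *: z) = a * ev s z.
  have e0 : ev s 0 = 0 by rewrite -(subrr 0) evB subrr.
  by rewrite -[a *: z]addr0 evl e0 addr0.
have evS s n (z : nat -> V) : ev s (\sum_(i < n) z i) = \sum_(i < n) ev s (z i).
  pose h : {linear V -> R^o} := HB.pack (ev s) (GRing.isLinear.Build _ _ _ _ _ (evl s)).
  by rewrite -[ev s]/(h : _ -> _) linear_sum.
have diff1 i j : `|G i - G j| <= 1.
  apply: evN => // s; rewrite evB !evG.
  by case: (g i s) (g j s) => [] []; rewrite ?subrr ?subr0 ?sub0r ?normrN ?normr0 ?normr1.
have [sigma [v [eps [eta fv]]]] := separated_subsequence gd.
have [eta_eps|eta_eps] := eqVneq eta eps; last first.
  have {eta_eps} eta_eps : eta = ~~ eps by case: (eta) (eps) eta_eps => [] [].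
  left; exists 1, (fun k => (-1) ^+ (~~ eps) *: (G (sigma k.+1) - G (sigma 0%N))),
    (fun m => ev (v m)).
  split=> [k _|//|//|m k _ _]; first by rewrite normrZ normr_sign mul1r.
  rewrite evZ evB !evG !fv ltn0 ltnS eta_eps !if_same.
  by case: (m <= k)%N (eps) => [] []; rewrite /= ?subrr ?mulr0 ?subr0 ?sub0r
    ?expr0 ?expr1 ?mul1r ?mulN1r ?opprK.
subst eta; pose f j := g (sigma j).
have {}fv i j : f j (v i) = eps (+) (i == j).
  by rewrite /f fv; case: ltngtP => _; rewrite ?addbF ?addbT.
have [U [UU Uoo]] := exists_free_ultrafilter.
pose alt t := exists s, alternates (fun i => f i s) t.
have altE (tau : nat -> nat) t s :
    alternates (fun i => f (tau i) s) t <-> alternates (fun i => f i s) (map tau t).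
  by split=> a l; have := a l; rewrite size_map => + lt => /(_ lt);
    rewrite (nth_map 0%N).
have [[d dN]|allN] := pselect (exists d, large U d.*2 (fun t => ~ alt t) [::]).
  left; have [tau tau_inc tauN] := large_homogeneous UU Uoo dN.
  have tau_inj : injective tau.
    by move=> i j ij; case: (ltngtP i j) => // /tau_inc; rewrite ij ltnn.
  pose D i := G (sigma (tau i.*2.+1)) - G (sigma (tau i.*2)).
  exists d%:R, (fun k => (-1) ^+ eps *: \sum_(i < k.+1) D i),
    (fun m => ev (v (tau m.*2.+1))).
  split=> [k _|//|//|m k _ _].
    rewrite normrZ normr_sign mul1r; apply: evN => // s.
    rewrite evS; under eq_bigr => i _ do rewrite /D evB !evG.
    apply: (@no_alternation_bound R (fun i => f (tau i) s) d k.+1) => t ts td /altE ta.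
    by apply: (tauN t) => //; exists s.
  rewrite evZ evS.
  under eq_bigr => i _.
    rewrite /D evB !evG -!/(f _ _) !fv !(inj_eq tau_inj).
    have -> : (m.*2.+1 == i.*2) = false by apply/negbTE; lia.
    have -> : (m.*2.+1 == i.*2.+1) = (m == i :> nat) by apply/eqP/eqP; lia.
    over.
  rewrite /= mulr_sumr; have [mk|km] := leqP m k.
    rewrite (bigD1 (Ordinal (n := k.+1) mk))//= eqxx big1 ?addr0.
      by case: (eps); rewrite /= ?expr0 ?expr1; lra.
    move=> i; rewrite -val_eqE /= eq_sym => /negbTE ->.
    by rewrite addbF subrr mulr0.
  rewrite big1// => i _; rewrite (_ : (m == i :> nat) = false).
    by rewrite addbF subrr mulr0.
  by apply/negbTE; have := ltn_ord i; lia.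
right=> n.
have [nalt|nN] := large_or_not n.*2.*2 alt [::] UU; last first.
  by exfalso; apply: allN; exists n.*2.
have [tau _ tau_alt] := large_homogeneous UU Uoo nalt.
exists (fun k => G (sigma (tau (5 * k).+2)) - G (sigma (tau (5 * k).+1))) => // e.
have [|s sP] := @alternation_shatters S (fun i => f (tau i)) n _ e.
  by move=> t ts tn; have [s sa] := tau_alt t ts tn; exists s; exact/(altE tau t s).
exists s => k kn; have [s1 s2] := sP k kn.
rewrite evB !evG -!/(f _ _) s1 s2.
by case: (e k); rewrite ?expr1 ?expr0 ?sub0r ?subr0.
Qed.

(** * Euclidean norms from finite samples *)

(** Cauchy-Schwarz: with [X] and [Y] the two norms, both nonzero, sum over [i] the
    inequality [2 x_i y_i <= x_i^2 Y/X + y_i^2 X/Y]. *)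
Lemma dot_le_norms (R : realType) (n : nat) (x y : 'I_n -> R) :
  \sum_(i < n) x i * y i <=
  Num.sqrt (\sum_(i < n) x i ^+ 2) * Num.sqrt (\sum_(i < n) y i ^+ 2).
Proof.
set p := \sum_(i < n) x i ^+ 2; set q := \sum_(i < n) y i ^+ 2.
have p0 : 0 <= p by apply: sumr_ge0 => i _; exact: sqr_ge0.
have q0 : 0 <= q by apply: sumr_ge0 => i _; exact: sqr_ge0.
have vanish (z : 'I_n -> R) : \sum_(i < n) z i ^+ 2 = 0 -> forall i, z i = 0.
  move=> z0 i; apply/eqP; rewrite -sqrf_eq0; apply/eqP.
  by apply: (psumr_eq0P _ z0) => // j _; exact: sqr_ge0.
have [p_0|p_n0] := eqVneq p 0.
  by rewrite p_0 sqrtr0 mul0r big1// => i _; rewrite vanish ?mul0r.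
have [q_0|q_n0] := eqVneq q 0.
  by rewrite q_0 sqrtr0 mulr0 big1// => i _; rewrite (vanish y) ?mulr0.
have X0 : 0 < Num.sqrt p by rewrite sqrtr_gt0 lt_neqAle eq_sym p_n0.
have Y0 : 0 < Num.sqrt q by rewrite sqrtr_gt0 lt_neqAle eq_sym q_n0.
have pE : p = Num.sqrt p ^+ 2 by rewrite sqr_sqrtr.
have qE : q = Num.sqrt q ^+ 2 by rewrite sqr_sqrtr.
move: X0 Y0 pE qE; set X := Num.sqrt p; set Y := Num.sqrt q => X0 Y0 pE qE.
have -> : X * Y = \sum_(i < n) (x i ^+ 2 * (Y / X) + y i ^+ 2 * (X / Y)) / 2.
  rewrite -mulr_suml big_split /= -!mulr_suml -/p -/q pE qE.
  by field; rewrite !gt_eqF.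
apply: ler_sum => i _; rewrite -subr_ge0.
have -> : (x i ^+ 2 * (Y / X) + y i ^+ 2 * (X / Y)) / 2 - x i * y i =
    (x i * Y - y i * X) ^+ 2 / (2 * X * Y) by field; rewrite !gt_eqF.
by rewrite divr_ge0 ?sqr_ge0// !mulr_ge0// ltW.
Qed.

Definition sample_norm (R : realType) (V : lmodType R) (n : nat)
    (c : 'I_n -> V -> R^o) (z : V) : R := Num.sqrt (\sum_(i < n) c i z ^+ 2).

Lemma sample_norm_sqr (R : realType) (V : lmodType R) (n : nat)
    (c : 'I_n -> V -> R^o) (z : V) :
  sample_norm c z ^+ 2 = \sum_(i < n) c i z ^+ 2.
Proof. by rewrite sqr_sqrtr// sumr_ge0// => i _; exact: sqr_ge0. Qed.

Lemma sample_norm_equivalent (R : realType) (V : normedModType R) (n : nat)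
    (c : 'I_n -> V -> R^o) :
  (forall i, linear (c i)) -> (forall i z, `|c i z| <= `|z|) ->
  (forall z (M : R), 0 <= M -> (forall i, `|c i z| <= M) -> `|z| <= M) ->
  equivalent_norm (sample_norm c).
Proof.
move=> cl c1 cN; set N := sample_norm c.
have N0 z : 0 <= N z by exact: sqrtr_ge0.
have cZ i a z : c i (a *: z) = a * c i z.
  have c0 : c i 0 = 0.
    by have := cl i (-1) 0 0; rewrite scaler0 addr0 scaleN1r addNr.
  by rewrite -[a *: z]addr0 cl c0 addr0.
have cD i y z : c i (y + z) = c i y + c i z.
  by rewrite -[y]scale1r cl !scale1r.
have low z : `|z| <= N z.
  apply: cN => // i; rewrite -sqrtr_sqr ler_wsqrtr//.
  rewrite (bigD1 i)//= lerDl; apply: sumr_ge0 => j _; exact: sqr_ge0.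
have up z : N z <= n.+1%:R * `|z|.
  rewrite -[leRHS]ger0_norm ?mulr_ge0// -sqrtr_sqr ler_wsqrtr//.
  apply: (@le_trans _ _ (\sum_(i < n) `|z| ^+ 2)).
    by apply: ler_sum => i _; rewrite -real_normK ?num_real// lerXn2r ?nnegrE.
  rewrite sumr_const card_ord -[leLHS]mulr_natl exprMn ler_wpM2r ?sqr_ge0//.
  by rewrite -natrX ler_nat; lia.
split; last by exists 1, n.+1%:R; split=> // z; rewrite mul1r low up.
split=> [y z|a z|z Nz].
- rewrite -ler_sqr ?nnegrE ?addr_ge0// sqrrD !sample_norm_sqr.
  under eq_bigr => i _ do rewrite cD sqrrD.
  rewrite !big_split /= lerD2r lerD2l mulr2n.
  by apply: lerD; exact: dot_le_norms.
- rewrite /N /sample_norm; under eq_bigr => i _ do rewrite cZ exprMn.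
  by rewrite -mulr_sumr sqrtrM ?sqr_ge0// sqrtr_sqr.
- by apply/normr0_eq0/eqP; rewrite eq_le normr_ge0 andbT -Nz low.
Qed.

(** The parallelogram law. *)
Lemma sample_norm_uniformly_convex (R : realType) (V : lmodType R) (n : nat)
    (c : 'I_n -> V -> R^o) :
  (forall i, linear (c i)) -> uniformly_convex (sample_norm c).
Proof.
move=> cl e e0; set N := sample_norm c.
have N0 z : 0 <= N z by exact: sqrtr_ge0.
have cB i y z : c i (y - z) = c i y - c i z.
  by rewrite -[y - z]addrC -scaleN1r cl scaleN1r addrC.
have cM i y z : c i (2^-1 *: (y + z)) = (c i y + c i z) / 2.
  have c0 : c i 0 = 0 by rewrite -(subrr 0) cB subrr.
  rewrite -[2^-1 *: _]addr0 cl c0 addr0 -[y]scale1r cl !scale1r.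
  by rewrite -[LHS]/(2^-1 * _) mulrC.
(* (1 - e^2/8)^2 exceeds the bound 1 - e^2/4 given by the parallelogram law. *)
exists (e ^+ 2 / 8); first by rewrite divr_gt0// exprn_gt0.
move=> y z y1 z1 eyz.
have par : N (2^-1 *: (y + z)) ^+ 2 =
    (N y ^+ 2 + N z ^+ 2) / 2 - N (y - z) ^+ 2 / 4.
  rewrite !sample_norm_sqr -big_split /= !mulr_suml -sumrB; apply: eq_bigr => i _.
  by rewrite cM cB; field.
have e2 : e ^+ 2 <= N (y - z) ^+ 2 by rewrite lerXn2r ?nnegrE// ltW.
move: par; rewrite y1 z1; set m := N (2^-1 *: (y + z)) => par.
have m0 : 0 <= m ^+ 2 by exact: sqr_ge0.
have d0 : 0 <= 1 - e ^+ 2 / 8 by lra.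
rewrite -ler_sqr ?nnegrE//; last exact: N0.
have : 0 <= (e ^+ 2 / 8) ^+ 2 by exact: sqr_ge0.
have -> : (1 - e ^+ 2 / 8) ^+ 2 = 1 - e ^+ 2 / 4 + (e ^+ 2 / 8) ^+ 2 by field.
by lra.
Qed.

(** * Languages *)

Lemma lderiv_cat (Sigma : finType) (L : set (seq Sigma)) (u w : seq Sigma) :
  lderiv (u ++ w) L = lderiv w (lderiv u L).
Proof. by apply/seteqP; split=> v; rewrite /lderiv /= catA. Qed.

(** Myhill-Nerode: the states are representatives of the derivatives. *)
Lemma finite_derivatives_regular (Sigma : finType) (L : set (seq Sigma))
    (ws : seq (seq Sigma)) :
  (forall w, exists2 u, u \in ws & lderiv w L = lderiv u L) -> regular L.
Proof.
move=> wsL; pose D (q : 'I_(size ws)) := lderiv (tnth (in_tuple ws) q) L.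
have /choice[c cP] : forall w, exists q, lderiv w L = D q.
  move=> w; have [u /(tnthP (in_tuple ws))[q ->] wu] := wsL w; by exists q.
pose delta q a := c (tnth (in_tuple ws) q ++ [:: a]).
have run w q : D (foldl delta q w) = lderiv w (D q).
  elim: w q => [|a w IH] q //=.
  by rewrite IH -cP lderiv_cat -lderiv_cat.
exists 'I_(size ws), (c [::]), delta, [set q | `[< D q [::] >]]%SET.
apply/funext => w /=; rewrite inE run -cP; apply/propext.
by split=> [Lw|/asboolP]; [apply/asboolP|]; rewrite /lderiv /= cats0.
Qed.

Lemma nonregular_derivatives (Sigma : finType) (L : set (seq Sigma)) :
  ~ regular L -> exists w : nat -> seq Sigma, forall i j, i != j ->
    exists s, (s \in lderiv (w i) L) <> (s \in lderiv (w j) L).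
Proof.
move=> Lreg.
have /choice[nx nxP] : forall ws : seq (seq Sigma), exists w,
    forall u, u \in ws -> lderiv w L <> lderiv u L.
  move=> ws; apply: contrapT => wsN; apply: Lreg.
  apply: (@finite_derivatives_regular _ _ ws) => w; apply: contrapT => wN.
  by apply: wsN; exists w => u uws wu; apply: wN; exists u.
pose fix A k := if k is k'.+1 then rcons (A k') (nx (A k')) else [::].
have wA i j : (i < j)%N -> nx (A i) \in A j.
  elim: j => // j IH; rewrite ltnS leq_eqVlt => /predU1P[->|/IH ij] /=.
    by rewrite mem_rcons mem_head.
  by rewrite mem_rcons in_cons ij orbT.
exists (nx \o A) => i j ij /=; apply: contrapT => sN.
have dij : lderiv (nx (A i)) L = lderiv (nx (A j)) L.
  suff E s : (s \in lderiv (nx (A i)) L) = (s \in lderiv (nx (A j)) L).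
    by apply/seteqP; split=> s si; apply/set_mem; [rewrite -E|rewrite E]; exact/mem_set.
  by apply: contrapT => sne; apply: sN; exists s.
move: ij; rewrite neq_ltn => /orP[] /wA /nxP; exact.
Qed.

Definition word_eval (R : realType) (Sigma : finType) (L : set (seq Sigma))
    (t : seq Sigma) (z : XL R L) : R^o := linfty_fun (clspan_val z) t.

Lemma word_eval_linear (R : realType) (Sigma : finType) (L : set (seq Sigma))
    (t : seq Sigma) : linear (@word_eval R Sigma L t).
Proof. exact: clspan_linear (@linfty_eval_linear R _ t). Qed.

Lemma word_eval_le (R : realType) (Sigma : finType) (L : set (seq Sigma))
    (t : seq Sigma) (z : XL R L) : `|word_eval t z| <= `|z|.
Proof. exact: sup_norm_ub. Qed.

Lemma word_eval_norming (R : realType) (Sigma : finType) (L : set (seq Sigma))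
    (z : XL R L) (M : R) :
  0 <= M -> (forall t, `|word_eval t z| <= M) -> `|z| <= M.
Proof. exact: sup_norm_le. Qed.

Lemma nonregular_dichotomy (R : realType) (Sigma : finType) (L : set (seq Sigma)) :
  ~ regular L ->
  (exists A (x : nat -> XL R L) p, staircase setT A x p) \/
  (forall n, exists2 y : nat -> XL R L, forall k, `|y k| <= 1 &
    forall e : nat -> bool, exists t, forall k, (k < n)%N ->
      word_eval t (y k) = (-1) ^+ e k).
Proof.
move=> /nonregular_derivatives[w wd].
pose S := [set linfty_indic R (lderiv u L) | u in [set: seq Sigma]].
have dS u : linfty_indic R (lderiv u L) \in clspan_pred S by apply: mem_clspan; exists u.
have evd i s : word_eval s (Clspan (dS (w i)) : XL R L) = (s \in lderiv (w i) L)%:R.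
  by rewrite -indicE.
exact: (zero_one_dichotomy (@word_eval_linear R _ L) (@word_eval_le R _ L)
  (@word_eval_norming R _ L) evd wd).
Qed.

Lemma nonregular_not_superreflexive (R : realType) (Sigma : finType)
    (L : set (seq Sigma)) : ~ regular L -> ~ superreflexive (XL R L).
Proof.
move=> /(nonregular_dichotomy R)[[A [x [p xp]]] sr|sh].
  by apply: (staircase_not_reflexive xp); apply: sr; exact: finitely_representable_refl.
exact: shattering_not_superreflexive (@word_eval_linear R _ L)
  (@word_eval_le R _ L) sh.
Qed.

Lemma nonregular_not_uniformly_convex (R : realType) (Sigma : finType)
    (L : set (seq Sigma)) (N : XL R L -> R) :
  ~ regular L -> equivalent_norm N -> ~ uniformly_convex N.
Proof.
move=> /(nonregular_dichotomy R)[[A [x [p [xA pl p1 px]]]]|sh].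
  by apply: (@staircases_not_uniformly_convex _ _ A) => n; exists x, p; split=> // *;
    [exact: xA|exact: px].
apply: (@staircases_not_uniformly_convex _ _ 1) => n; have [y y1 ysh] := sh n.
exists y; exact: shattering_staircase (@word_eval_linear R _ L)
  (@word_eval_le R _ L) y1 ysh.
Qed.

(** Two words inducing the same transition map on the states are not
    distinguished by any derivative of [L], hence by no function in their closed
    span; and there are finitely many transition maps. *)
Lemma regular_sample (R : realType) (Sigma : finType) (L : set (seq Sigma)) :
  regular L -> exists n (v : 'I_n -> seq Sigma), forall t, exists i,
    forall z : XL R L, word_eval t z = word_eval (v i) z.
Proof.
move=> [Q [q0 [delta [final LE]]]].
pose tr w : {ffun Q -> Q} := [ffun q => foldl delta q w].
have trE t u : tr t = tr u -> forall z : XL R L, word_eval t z = word_eval u z.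
  move=> tu z; apply/eqP; rewrite -subr_eq0 -normr_le0; apply/ler_addgt0Pr => e e0.
  rewrite add0r.
  have /asboolP/(_ (ball (clspan_val z) (e / 2))) := clspan_valP z.
  case; first by apply: nbhsx_ballx; rewrite divr_gt0.
  move=> g [[n [a [h [hS gE]]]]]; rewrite -ball_normE /ball_ /= => zg.
  have gtu : g t = g u.
    rewrite gE; apply: (big_ind (fun f : linfty R (seq Sigma) => f t = f u)) => //.
      by move=> f1 f2 e1 e2; rewrite -[LHS]/(f1 t + f2 t) e1 e2.
    move=> i _; have [w _ <-] := hS i.
    rewrite -[LHS]/(a i * \1_(lderiv w L) t) -[RHS]/(a i * \1_(lderiv w L) u).
    congr (_ * _); rewrite !indicE; congr (nat_of_bool _)%:R.
    apply/idP/idP; rewrite !inE /lderiv /= LE /= !foldl_cat;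
    by have /ffunP/(_ (foldl delta q0 w)) := tu; rewrite !ffunE => ->.
  have lip s : `|word_eval s z - g s| <= e / 2.
    by apply: le_trans (ltW zg); exact: (sup_norm_ub (clspan_val z - g) s).
  rewrite -(subrKA (g t)) [e]splitr (le_trans (ler_normD _ _))// lerD ?lip//.
  by rewrite gtu distrC lip.
have /choice[rep repP] : forall k : {ffun Q -> Q}, exists v,
    (exists v', tr v' = k) -> tr v = k.
  move=> k; have [[v' <-]|kN] := pselect (exists v', tr v' = k); first by exists v'.
  by exists [::] => /kN.
exists #|{ffun Q -> Q}|, (rep \o enum_val) => t; exists (enum_rank (tr t)) => z /=.
by apply: trE; rewrite enum_rankK repP//; exists t.
Qed.

Theorem corollary3p2 (R : realType) (Sigma : finType)
    (Sigma_nonempty : (0 < #|Sigma|)%N) (L : set (seq Sigma)) :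
  [<-> regular L;
       finite_dimensional (XL R L);
       superreflexive (XL R L);
       exists2 N : XL R L -> R, equivalent_norm N & uniformly_convex N].
Proof.
have sample : regular L -> exists n (c : 'I_n -> XL R L -> R^o),
    [/\ forall i, linear (c i), forall i z, `|c i z| <= `|z| &
        forall z (M : R), 0 <= M -> (forall i, `|c i z| <= M) -> `|z| <= M].
  move=> /(regular_sample R)[n [v vP]]; exists n, (fun i => word_eval (v i)).
  split=> [i|i z|z M M0 zM]; first exact: word_eval_linear.
    exact: word_eval_le.
  by apply: word_eval_norming => // t; have [i ->] := vP t.
tfae.
- move=> /sample[n [c [cl _ cN]]].
  apply: (finite_dimensional_embedding (J := fun z => \row_i (c i z : R))).
    by move=> a y z; apply/rowP => i; rewrite !mxE cl.
  move=> z /rowP z0; apply/normr0_eq0/eqP; rewrite eq_le normr_ge0 andbT.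
  by apply: cN => // i; have := z0 i; rewrite !mxE => ->; rewrite normr0.
- move=> XLfin Y YX; apply: finite_dimensional_reflexive.
  exact: finite_dimensional_representable XLfin YX.
- move=> sr; have /sample[n [c [cl c1 cN]]] : regular L.
    by apply: contrapT => Lreg; exact: (nonregular_not_superreflexive Lreg sr).
  exists (sample_norm c); first exact: sample_norm_equivalent.
  exact: sample_norm_uniformly_convex.
- move=> [N Neq Nuc]; apply: contrapT => Lreg.
  exact: (nonregular_not_uniformly_convex Lreg Neq Nuc).
Qed.
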